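(* Let $F$ be an interpolation sequence space between $l_1$ and $l_2$, and let $F=(l_1,l_2)^{\mathcal{K}}_E$. Then for the rearrangement invariant space $X=(L_\infty,G)^{\mathcal{K}}_E$ we have $$\Bigl\|\sum_{k=1}^\infty a_k r_k\Bigr\|_X\asymp\|a\|_F,$$ with constants independent of $a=(a_k)_{k=1}^\infty$.
   Context: All function spaces consist of measurable functions on $[0,1]$ with Lebesgue measure; $r_k(t)=\operatorname{sign}\sin(2^{k-1}\pi t)$, $k=1,2,\dots$, are the Rademacher functions. A Banach space $X$ of measurable functions on $[0,1]$ is rearrangement invariant if $x^*(t)\le y^*(t)$ for $t\in[0,1]$ and $y\in X$ imply $x\in X$ and $\|x\|\le\|y\|$, where $z^*$ is the nonincreasing rearrangement of $|z|$. For $p\ge 1$, $l_p$ has norm $\|a\|_p=(\sum_{k=1}^\infty|a_k|^p)^{1/p}$ (real sequences indexed by $k\ge1$). The Orlicz space $L_N$ with $N(t)=\exp(t^2)-1$ has norm $\|x\|_N=\inf\{u>0:\int_0^1 N(|x(t)|/u)\,dt\le1\}$, and $G$ is the closure of $L_\infty$ in $L_N$ with the norm of $L_N$. For a Banach couple $(X_0,X_1)$, $x\in X_0+X_1$, $t>0$: $$\mathcal{K}(t,x;X_0,X_1)=\inf\{\|x_0\|_{X_0}+t\|x_1\|_{X_1}: x=x_0+x_1,\ x_0\in X_0,\ x_1\in X_1\}.$$ A linear operator $U$ is bounded from a couple $(X_0,X_1)$ into a couple $(Y_0,Y_1)$ if it is defined on $X_0+X_1$ and acts boundedly from $X_i$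 into $Y_i$, $i=0,1$. A space $X$ with $X_0\cap X_1\subset X\subset X_0+X_1$ is an interpolation space between $X_0$ and $X_1$ if every linear operator bounded from the couple $(X_0,X_1)$ into itself is bounded from $X$ into itself. Let $E$ be a Banach lattice of two-sided real sequences with $(\min(1,2^k))_{k=-\infty}^\infty\in E$. The space $(X_0,X_1)^{\mathcal{K}}_E$ of the real $\mathcal{K}$-method consists of all $x\in X_0+X_1$ with $$\|x\|=\bigl\|(\mathcal{K}(2^k,x;X_0,X_1))_{k=-\infty}^\infty\bigr\|_E<\infty.$$ (For every interpolation space $F$ between $l_1$ and $l_2$ there is such an $E$ with $F=(l_1,l_2)^{\mathcal{K}}_E$.) The symbol $\asymp$ means two-sided estimates up to positive multiplicative constants. Here $a$ ranges over $l_2$, and a norm is $+\infty$ when the element does not belong to the space. *)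

(* Defs.v *)
From HB Require Import structures.
From mathcomp Require Import all_boot all_order all_algebra.
From mathcomp Require Import all_classical all_reals all_analysis.

Set Implicit Arguments.
Unset Strict Implicit.
Unset Printing Implicit Defensive.

Import Order.TTheory GRing.Theory Num.Theory.
Import numFieldNormedType.Exports.

Local Open Scope classical_set_scope.
Local Open Scope ring_scope.

(* Conventions.
   - A normed space X contained in an ambient vector space V is given by its
     extended norm nrm : V -> \bar R, with the value +oo outside X; thus
     "x \in X" is nrm x < +oo.
   - Sequences (a_k)_{k >= 1} are functions a : nat -> R, where a k stands for
     the term of index k + 1.
   - Functions on [0, 1] are functions R -> R of which only the restriction to
     [0, 1] matters; almost everywhere equal functions are identified, which is
     expressed by the set Z of null elements in is_banach below. Measurability
     is Borel measurability, which gives the same classes as Lebesgue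
     measurability. *)

Section abstract_spaces.
Context {R : realType}.
Local Open Scope ereal_scope.

Definition in_space {V : Type} (nrm : V -> \bar R) (x : V) : Prop :=
  nrm x < +oo.

Definition is_banach {V : lmodType R} (Z : set V) (nrm : V -> \bar R) : Prop :=
  [/\ (forall x, 0 <= nrm x),
      (forall x, nrm x = 0 <-> Z x),
      (forall (c : R) x, nrm (c *: x)%R = `|c|%:E * nrm x),
      (forall x y, nrm (x + y)%R <= nrm x + nrm y) &
      (forall u : nat -> V, (forall n, in_space nrm (u n)) ->
        (forall e : R, (0 < e)%R -> exists N : nat,
          forall m n, (N <= m)%N -> (N <= n)%N -> nrm (u m - u n)%R < e%:E) ->
        exists2 l, in_space nrm l &
          nrm (u n - l)%R @[n --> \oo] --> 0)].

Definition norms_asymp_on {T : Type} (D : set T) (f g : T -> \bar R) : Prop :=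
  exists c C : R, [/\ (0 < c)%R, (0 < C)%R &
    forall x, D x -> c%:E * g x <= f x /\ f x <= C%:E * g x].

Section couples.
Context {V : lmodType R}.

Definition in_sum (n0 n1 : V -> \bar R) (x : V) : Prop :=
  exists x0 x1, [/\ x = (x0 + x1)%R, in_space n0 x0 & in_space n1 x1].

Definition K_functional (n0 n1 : V -> \bar R) (t : R) (x : V) : \bar R :=
  ereal_inf [set r | exists x0 x1, [/\ x = (x0 + x1)%R,
    in_space n0 x0, in_space n1 x1 & r = n0 x0 + t%:E * n1 x1]].

Definition K_method (n0 n1 : V -> \bar R) (E : (int -> R) -> \bar R)
    (x : V) : \bar R :=
  if `[< in_sum n0 n1 x >]
  then E (fun k : int => fine (K_functional n0 n1 (2%:R ^ k)%R x))
  else +oo.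

End couples.

Definition bounded_into {V W : lmodType R} (nV : V -> \bar R)
    (nW : W -> \bar R) (U : V -> W) : Prop :=
  exists C : R, forall x, in_space nV x -> nW (U x) <= C%:E * nV x.

(* U is total on V, but only its restriction to X_0 + X_1 is constrained. *)
Definition bounded_couple_operator {V W : lmodType R}
    (n0 n1 : V -> \bar R) (m0 m1 : W -> \bar R) (U : V -> W) : Prop :=
  [/\ (forall (c : R) x y, in_sum n0 n1 x -> in_sum n0 n1 y ->
        U (c *: x + y)%R = (c *: U x + U y)%R),
      bounded_into n0 m0 U & bounded_into n1 m1 U].

Definition interpolation_space {V : lmodType R}
    (n0 n1 nrm : V -> \bar R) : Prop :=
  [/\ (forall x, in_space n0 x -> in_space n1 x -> in_space nrm x),
      (forall x, in_space nrm x -> in_sum n0 n1 x) &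
      forall U : V -> V, bounded_couple_operator n0 n1 n0 n1 U ->
        bounded_into nrm nrm U].

Definition is_banach_sequence_lattice (E : (int -> R) -> \bar R) : Prop :=
  is_banach [set 0%R] E /\
  forall x y : int -> R, (forall k, `|x k| <= `|y k|)%R -> in_space E y ->
    in_space E x /\ E x <= E y.

End abstract_spaces.

Section concrete_spaces.
Context {R : realType}.
Local Notation mu := (@lebesgue_measure R).
Local Notation I01 := (`[0%R, 1%R]%classic : set R).

Definition lp_norm (p : R) (a : nat -> R) : \bar R :=
  ('N[counting]_(p%:E)[EFin \o a])%E.

Definition Linfty_norm (x : R -> R) : \bar R :=
  if `[< measurable_fun I01 x >] then ('N[mu]_+oo[EFin \o (x \_ I01)])%E else +oo%E.

Definition orlicz_norm (N : R -> R) (x : R -> R) : \bar R :=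
  if `[< measurable_fun I01 x >] then
    ereal_inf [set u%:E | u in [set u : R | 0 < u /\
      (\int[mu]_(t in I01) (N (`|x t| / u))%:E <= 1)%E]]
  else +oo%E.

Definition LN_norm : (R -> R) -> \bar R :=
  orlicz_norm (fun t => expR (t ^+ 2) - 1).

Definition G_norm (x : R -> R) : \bar R :=
  if `[< in_space LN_norm x /\
         forall e : R, 0 < e -> exists2 y : R -> R,
           in_space Linfty_norm y & (LN_norm (x - y)%R < e%:E)%E >]
  then LN_norm x else +oo%E.

Definition rearrangement (x : R -> R) (t : R) : \bar R :=
  ereal_inf [set s%:E | s in [set s : R | 0 <= s /\
    (mu (I01 `&` [set u | (s < `|x u|)%R]) <= t%:E)%E]].

Definition rearrangement_invariant (X : (R -> R) -> \bar R) : Prop :=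
  [/\ is_banach
        [set x : R -> R | measurable_fun I01 x /\
                          {ae mu, forall t, I01 t -> x t = 0}] X,
      (forall x, in_space X x -> measurable_fun I01 x) &
      forall x y : R -> R, measurable_fun I01 x -> in_space X y ->
        (forall t, I01 t -> (rearrangement x t <= rearrangement y t)%E) ->
        in_space X x /\ (X x <= X y)%E].

(* rademacher k is r_{k+1}(t) = sign sin(2^k pi t). *)
Definition rademacher (k : nat) (t : R) : R :=
  Num.sg (sin (2%:R ^+ k * pi * t)).

(* For a in l_2 the series converges almost everywhere on [0, 1]. *)
Definition rademacher_sum (a : nat -> R) (t : R) : R :=
  limn (series (fun k => a k * rademacher k t)).

End concrete_spaces.

(* Main.v *)
Require Import Defs.
From HB Require Import structures.
From mathcomp Require Import all_boot all_order all_algebra.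
From mathcomp Require Import all_classical all_reals all_analysis.
From mathcomp Require Import measurable_realfun ess_sup_inf.
From mathcomp Require Import ring lra zify.

(** The heart of the matter is that, for t > 0 and a in l_2,
      K(t, sum_k a_k r_k; L_oo, G) and K(t, a; l_1, l_2)
    agree up to absolute constants; the two-sided estimate then passes through
    the lattice norm of E.

    Upper estimate [K_rademacher_sum_le]. The operator T a = sum_k a_k r_k maps
    l_1 into L_oo with norm 1, and l_2 into G by the exponential-square form of
    Khintchine's inequality [LN_rademacher_sum]; a decomposition of a is
    therefore sent to one of T a.

    Lower estimate [K_rademacher_sum_ge]. Let T a = x0 + x1. For a sequence b
    with |b_k| <= 1 and sum b_k^2 <= t^2, t >= 1, the Riesz product
    g = prod_(k > 1) (1 + b_k r_k) is a probability density with
    int g (T a) = a_1 + sum_(k > 1) a_k b_k; changing the sign of b if necessary,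
    the modulus of this integral is at least sum a_k b_k. The contribution of x0
    to it is at most its L_oo norm. For x1 the entropy of g is at most
    sum b_k^2 <= t^2, so that Young's inequality for the pair exp, u log u bounds
    int g x1^2 by O(t^2) times the square of the Orlicz norm of x1, hence
    int g |x1| by O(t) times that norm [dot_le_decomposition]. Choosing b as the
    truncation of a at a suitable level, divided by that level, makes sum a_k b_k
    comparable with K(t, a; l_1, l_2) [K_rademacher_take_ge].

    The first Rademacher function r_1 is the constant 1 on ]0, 1[, and only the
    remaining ones form a sequence of independent signs. Whenever the
    distribution of sign sums matters, independence is used in the recursive
    form [integral_sign_seq]: halving [0, 1] fixes the first sign and
    reproduces the sequence of signs on either half. Khintchine's inequality
    [integral_gauss_sign_sum], Kolmogorov's maximal inequality
    [sign_maximal_inequality] and the duality with Riesz products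
    [riesz_product_duality] are each proved by induction on the number of
    terms, one sign being removed at a time. The maximal inequality yields the
    almost everywhere convergence of sum a_k r_k for a in l_2.

    That X is a rearrangement invariant Banach space is proved in two steps.
    Completeness holds for the K-method of any couple in which the first norm
    dominates the second, complete one [K_method_banach]; the completeness of G
    is the Riesz-Fischer theorem for the Orlicz space. Monotonicity under
    rearrangements already holds for each K(t, .; L_oo, G)
    [K_functional_tail_le]: when y = y0 + y1, truncating x at the level given by
    the L_oo norm of y0 leaves a remainder whose distribution function is
    dominated by that of y1. *)

Import Order.TTheory GRing.Theory Num.Theory.
Import numFieldNormedType.Exports.

Local Open Scope classical_set_scope.
Local Open Scope ring_scope.

Set Implicit Arguments.
Unset Strict Implicit.
Unset Printing Implicit Defensive.

(** * Extended reals and extended seminorms *)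

Section extended_reals.
Context {R : realType}.
Implicit Types (x y : \bar R) (f : nat -> \bar R).
Local Open Scope ereal_scope.

Lemma lee_of_ltR x y : (forall r : R, y < r%:E -> x <= r%:E) -> x <= y.
Proof.
case: y => [y| |] h.
- apply/lee_addgt0Pr => e e0; rewrite -EFinD; apply: h.
  by rewrite lte_fin ltrDl.
- by rewrite leey.
- case: x h => [x| |] h //.
  + by have := h (x - 1)%R (ltNyr _); rewrite lee_fin lerBrDr gerDl ler10.
  + by have := h 0%R (ltNyr _).
Qed.

Lemma cvge0P f : (forall n, 0 <= f n) ->
  (f n @[n --> \oo] --> 0) <->
  (forall e : R, (0 < e)%R ->
     exists N, forall n, (N <= n)%N -> f n < e%:E).
Proof.
move=> f0; split=> [/fine_cvgP[[M _ fM] fc] e e0|h].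
  have /cvgrPdist_lt/(_ _ e0)[N _ fN] := fc.
  exists (maxn M N) => n; rewrite geq_max => /andP[Mn Nn].
  have := fN n Nn; rewrite /= sub0r normrN ger0_norm ?fine_ge0// => h.
  by rewrite -[f n]fineK ?lte_fin//; exact: fM.
apply/fine_cvgP; split.
  have [N hN] := h 1%R ltr01; exists N => // n /= Nn.
  by rewrite ge0_fin_numE// (lt_trans (hN _ Nn))// ltry.
apply/cvgrPdist_lt => e e0; have [N hN] := h e e0.
exists N => // n /= Nn; rewrite sub0r normrN ger0_norm ?fine_ge0//.
rewrite -lte_fin fineK ?hN//.
by rewrite ge0_fin_numE// (lt_trans (hN _ Nn))// ltry.
Qed.

Lemma ge0_lty_fin x : 0 <= x -> x < +oo -> x = (fine x)%:E.
Proof. by move=> x0 xy; rewrite fineK// ge0_fin_numE. Qed.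

End extended_reals.

Section seminorms.
Context {R : realType} {V : lmodType R}.
Local Open Scope ereal_scope.

(** The part of [is_banach] that remains meaningful without completeness and
    without identifying the null elements. *)
Definition ext_seminorm (n : V -> \bar R) : Prop :=
  [/\ forall x, 0 <= n x,
      forall (c : R) x, n (c *: x)%R = `|c|%:E * n x &
      forall x y, n (x + y)%R <= n x + n y].

Lemma banach_seminorm Z n : is_banach Z n -> ext_seminorm n.
Proof. by case. Qed.

Variables (n : V -> \bar R) (sn : ext_seminorm n).

Lemma seminorm_ge0 x : 0 <= n x. Proof. by case: sn. Qed.

Lemma seminormZ (c : R) x : n (c *: x)%R = `|c|%:E * n x.
Proof. by case: sn. Qed.

Lemma seminormD x y : n (x + y)%R <= n x + n y. Proof. by case: sn. Qed.

Lemma seminorm0 : n 0%R = 0.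
Proof. by rewrite -(scale0r (0 : V)%R) seminormZ normr0 mul0e. Qed.

Lemma seminormN x : n (- x)%R = n x.
Proof. by rewrite -scaleN1r seminormZ normrN1 mul1e. Qed.

Lemma seminormC x y : n (x - y)%R = n (y - x)%R.
Proof. by rewrite -seminormN opprB. Qed.

Lemma seminorm_triangle z x y : n (x - y)%R <= n (x - z)%R + n (z - y)%R.
Proof. by apply: le_trans (seminormD _ _); rewrite addrA subrK. Qed.

Lemma in_spaceD x y : in_space n x -> in_space n y -> in_space n (x + y)%R.
Proof.
by move=> hx hy; apply: le_lt_trans (seminormD _ _) _; rewrite lte_add_pinfty.
Qed.

Lemma in_space0 : in_space n 0%R.
Proof. by rewrite /in_space seminorm0 ltry. Qed.

End seminorms.

(** * The K-functional of a couple *)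

Section K_functional_theory.
Context {R : realType}.
Local Open Scope ereal_scope.

Lemma K_functional_ub {V : lmodType R} (n0 n1 : V -> \bar R) (t : R) x0 x1 :
  in_space n0 x0 -> in_space n1 x1 ->
  K_functional n0 n1 t (x0 + x1)%R <= n0 x0 + t%:E * n1 x1.
Proof. by move=> h0 h1; apply: ereal_inf_lbound; exists x0, x1. Qed.

Lemma K_summand_fin {V : lmodType R} (n0 n1 : V -> \bar R) (t : R) x0 x1 :
  ext_seminorm n0 -> ext_seminorm n1 -> (0 <= t)%R ->
  in_space n0 x0 -> in_space n1 x1 -> n0 x0 + t%:E * n1 x1 \is a fin_num.
Proof.
move=> s0 s1 t0 h0 h1; rewrite (ge0_lty_fin (seminorm_ge0 s0 _) h0).
by rewrite (ge0_lty_fin (seminorm_ge0 s1 _) h1).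
Qed.

Lemma K_functional_ge0 {V : lmodType R} (n0 n1 : V -> \bar R) (t : R) x :
  ext_seminorm n0 -> ext_seminorm n1 -> (0 <= t)%R ->
  0 <= K_functional n0 n1 t x.
Proof.
move=> s0 s1 t0; apply: le_ereal_inf_tmp => _ [x0 [x1 [_ _ _ ->]]].
by rewrite adde_ge0 ?mule_ge0 ?(seminorm_ge0 s0) ?(seminorm_ge0 s1) ?lee_fin.
Qed.

Lemma K_functional_lty {V : lmodType R} (n0 n1 : V -> \bar R) (t : R) x :
  ext_seminorm n0 -> ext_seminorm n1 -> (0 <= t)%R ->
  in_sum n0 n1 x -> K_functional n0 n1 t x < +oo.
Proof.
move=> s0 s1 t0 [x0 [x1 [-> h0 h1]]].
apply: le_lt_trans (K_functional_ub t h0 h1) _.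
by rewrite ltey_eq K_summand_fin.
Qed.

(** Every estimate between two K-functionals, including homogeneity, reduces to
    transporting decompositions with control of both summands. *)
Lemma le_K_functional {V W : lmodType R} (n0 n1 : V -> \bar R)
    (m0 m1 : W -> \bar R) (C t : R) x y :
  ext_seminorm n0 -> ext_seminorm n1 -> ext_seminorm m0 -> ext_seminorm m1 ->
  (0 < C)%R -> (0 <= t)%R ->
  (forall y0 y1, y = (y0 + y1)%R -> in_space m0 y0 -> in_space m1 y1 ->
     exists x0 x1, [/\ x = (x0 + x1)%R, n0 x0 <= C%:E * m0 y0 &
       n1 x1 <= C%:E * m1 y1]) ->
  K_functional n0 n1 t x <= C%:E * K_functional m0 m1 t y.
Proof.
move=> s0 s1 sm0 sm1 C0 t0 h.
rewrite -lee_pdivrMl//; apply: le_ereal_inf_tmp => _ [y0 [y1 [yE h0 h1 ->]]].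
have [x0 [x1 [-> k0 k1]]] := h _ _ yE h0 h1.
rewrite lee_pdivrMl//.
have i0 : in_space n0 x0.
  apply: le_lt_trans k0 _.
  by rewrite (ge0_lty_fin (seminorm_ge0 sm0 _) h0) -EFinM ltry.
have i1 : in_space n1 x1.
  apply: le_lt_trans k1 _.
  by rewrite (ge0_lty_fin (seminorm_ge0 sm1 _) h1) -EFinM ltry.
apply: le_trans (K_functional_ub t i0 i1) _.
rewrite ge0_muleDr ?mule_ge0 ?lee_fin ?(seminorm_ge0 sm0) ?(seminorm_ge0 sm1)//.
by apply: leeD => //; rewrite muleCA lee_wpmul2l// lee_fin.
Qed.

Section one_couple.
Context {V : lmodType R}.
Variables (n0 n1 : V -> \bar R).
Hypotheses (s0 : ext_seminorm n0) (s1 : ext_seminorm n1).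
Variable t : R.
Hypothesis t0 : (0 <= t)%R.
Local Notation K := (K_functional n0 n1 t).

Lemma K_functionalD x y : K (x + y)%R <= K x + K y.
Proof.
have Kge0 z : 0 <= K z by exact: K_functional_ge0.
apply: lee_of_ltR => r hr.
have Kx : K x \is a fin_num.
  rewrite ge0_fin_numE//; apply: le_lt_trans (lt_trans hr (ltry r)).
  by rewrite leeDl.
move: hr; rewrite addeC -lteBrDr//.
move=> /ereal_inf_lt[_ [y0 [y1 [-> hy0 hy1 ->]]]].
rewrite lteBrDr// addeC -lteBrDr ?K_summand_fin//.
move=> /ereal_inf_lt[_ [x0 [x1 [-> hx0 hx1 ->]]]].
rewrite lteBrDr ?K_summand_fin// => /ltW; apply: le_trans.
rewrite addrACA.
apply: le_trans (K_functional_ub t (in_spaceD s0 hx0 hy0)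
  (in_spaceD s1 hx1 hy1)) _.
rewrite addeACA -ge0_muleDr ?(seminorm_ge0 s1)//.
by rewrite leeD ?(seminormD s0)// lee_wpmul2l ?lee_fin ?(seminormD s1).
Qed.

Lemma K_functionalZ_le (c : R) x : c != 0%R -> K (c *: x)%R <= `|c|%:E * K x.
Proof.
move=> c0; apply: le_K_functional => //; first by rewrite normr_gt0.
move=> x0 x1 -> _ _; exists (c *: x0)%R, (c *: x1)%R.
by rewrite scalerDr (seminormZ s0) (seminormZ s1).
Qed.

Lemma K_functionalZ (c : R) x : c != 0%R -> K (c *: x)%R = `|c|%:E * K x.
Proof.
move=> c0; apply/eqP; rewrite eq_le K_functionalZ_le//=.
rewrite muleC -lee_pdivlMr ?normr_gt0// muleC.
rewrite -normfV; apply: le_trans (K_functionalZ_le _ _); last first.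
  by rewrite invr_eq0.
by rewrite scalerA mulVf// scale1r.
Qed.

End one_couple.
End K_functional_theory.

(** * The K-method with a Banach sequence lattice *)

Section sequence_lattice.
Context {R : realType}.
Variable E : (int -> R) -> \bar R.
Hypothesis E_lattice : is_banach_sequence_lattice E.

Lemma lattice_seminorm : ext_seminorm E.
Proof. by case: E_lattice => /banach_seminorm. Qed.

Lemma lattice_le (x y : int -> R) :
  (forall k, `|x k| <= `|y k|) -> (E x <= E y)%E.
Proof.
move=> xy; have [Ey|] := ltP (E y) +oo%E; last by rewrite leye_eq => /eqP->; rewrite leey.
by have [] := E_lattice.2 x y xy Ey.
Qed.

Hypothesis E_min : in_space E (fun k : int => Num.min 1 (2%:R ^ k)).

(** The unit vector at k lies in E, being dominated by a multiple of
    (min(1, 2^j))_j; monotonicity of E on multiples of it bounds the coordinate.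
    Hence convergence in E implies coordinatewise convergence. *)
Lemma lattice_coord (k : int) : exists2 C : R, 0 < C &
  forall x, (`|x k|%:E <= C%:E * E x)%E.
Proof.
pose e (j : int) : R := (j == k)%:R.
have [[E0 Ez EZ _ _] _] := E_lattice.
have m0 : 0 < Num.min 1 (2%:R ^ k) :> R by rewrite lt_min ltr01 exprz_gt0.
have eE : in_space E e.
  pose m (j : int) : R := Num.min 1 (2%:R ^ j).
  have : (E e <= E ((m k)^-1 *: m)%R)%E.
    apply: lattice_le => j; rewrite /e /=.
    have [->|jk] := eqVneq j k; last by rewrite normr0.
    rewrite [X in _ <= `|X|](_ : _ = 1) //.
    exact: (mulVf (lt0r_neq0 m0)).
  move=> /le_lt_trans; apply.
  by rewrite EZ lte_mul_pinfty.
have Ee : (0 < E e)%E.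
  rewrite lt_neqAle E0 andbT eq_sym; apply/eqP => /Ez /(congr1 (fun f => f k)).
  by rewrite /e /= eqxx => /eqP; rewrite oner_eq0.
have EeE := ge0_lty_fin (E0 e) eE.
have fe0 : 0 < fine (E e) by rewrite -lte_fin -EeE.
exists (fine (E e))^-1; first by rewrite invr_gt0.
move=> x; rewrite -lee_pdivrMl ?invr_gt0// invrK -EeE.
rewrite muleC -EZ.
apply: lattice_le => j; rewrite -[X in `|X| <= _]/(x k * (j == k)%:R).
by have [->|jk] := eqVneq j k; rewrite ?mulr1 ?mulr0 ?normr0.
Qed.

End sequence_lattice.

Lemma half_expn_small {R : realType} (e : R) : 0 < e ->
  exists N, forall n, (N <= n)%N -> 2^-1 ^+ n < e.
Proof.
move=> e0; have : (fun n => 2^-1 ^+ n : R) @ \oo --> 0.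
  by apply: cvg_expr; rewrite ger0_norm ?invr_ge0// invf_lt1// ltr1n.
move/cvgrPdist_lt => /(_ e e0)[N _ hN]; exists N => n /hN /=.
by rewrite sub0r normrN ger0_norm// exprn_ge0// invr_ge0.
Qed.

Lemma half_gt0 (R : realType) : 0 < 2^-1 :> R.
Proof. by rewrite invr_gt0. Qed.

(** The gaps M j are also cofinal, so that limits along the subsequence agree
    with limits along the sequence. *)
Lemma fast_cauchy_subsequence {R : realType} {V : lmodType R}
    (nrm : V -> \bar R) (u : nat -> V) (delta : nat -> R) :
  (forall j, 0 < delta j) ->
  (forall e : R, 0 < e -> exists N : nat,
     forall m n, (N <= m)%N -> (N <= n)%N -> (nrm (u m - u n)%R < e%:E)%E) ->
  exists M : nat -> nat, [/\ forall j, (j <= M j)%N,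
    forall j, (M j <= M j.+1)%N &
    forall j m, (M j <= m)%N -> (nrm (u m - u (M j))%R < (delta j)%:E)%E].
Proof.
move=> delta0 uC.
have /boolp.choice[N hN] : forall j, exists N : nat, forall m n,
    (N <= m)%N -> (N <= n)%N -> (nrm (u m - u n)%R < (delta j)%:E)%E.
  by move=> j; exact: uC.
pose M j := (\sum_(i < j.+1) (N i).+1)%N.
have MS j : M j.+1 = (M j + (N j.+1).+1)%N by rewrite /M big_ord_recr.
have MN j : (N j <= M j)%N.
  by case: j => [|j]; rewrite ?MS /M ?big_ord1 ?leqnSn//; lia.
exists M; split=> [j|j|j m Mm].
- by elim: j => // j ih; rewrite MS; lia.
- by rewrite MS leq_addr.
- by apply: hN => //; exact: leq_trans Mm.
Qed.

Section K_method_theory.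
Context {R : realType}.
Variable E : (int -> R) -> \bar R.
Hypothesis E_lattice : is_banach_sequence_lattice E.
Hypothesis E_min : in_space E (fun k : int => Num.min 1 (2%:R ^ k)).

Lemma exp2z_gt0 (k : int) : 0 < 2%:R ^ k :> R. Proof. exact: exprz_gt0. Qed.

Lemma exp2z_ge0 (k : int) : 0 <= 2%:R ^ k :> R. Proof. exact: exprz_ge0. Qed.

Definition K_sequence {V : lmodType R} (n0 n1 : V -> \bar R) (x : V)
  (k : int) : R := fine (K_functional n0 n1 (2%:R ^ k) x).

Lemma K_methodE {V : lmodType R} (n0 n1 : V -> \bar R) x :
  in_sum n0 n1 x -> K_method n0 n1 E x = E (K_sequence n0 n1 x).
Proof. by move=> h; rewrite /K_method; case: asboolP. Qed.

Lemma K_method_in_sum {V : lmodType R} (n0 n1 : V -> \bar R) x :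
  in_space (K_method n0 n1 E) x -> in_sum n0 n1 x.
Proof. by rewrite /in_space /K_method; case: asboolP => // _; rewrite ltxx. Qed.

Lemma K_sequence_ge0 {V : lmodType R} (n0 n1 : V -> \bar R) x k :
  ext_seminorm n0 -> ext_seminorm n1 -> 0 <= K_sequence n0 n1 x k.
Proof. by move=> s0 s1; rewrite fine_ge0// K_functional_ge0// exp2z_ge0. Qed.

Lemma K_sequenceE {V : lmodType R} (n0 n1 : V -> \bar R) x k :
  ext_seminorm n0 -> ext_seminorm n1 -> in_sum n0 n1 x ->
  K_functional n0 n1 (2%:R ^ k) x = (K_sequence n0 n1 x k)%:E.
Proof.
move=> s0 s1 h; apply: ge0_lty_fin.
  by rewrite K_functional_ge0// exp2z_ge0.
by rewrite K_functional_lty// exp2z_ge0.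
Qed.

Lemma le_K_method {V W : lmodType R} (n0 n1 : V -> \bar R)
    (m0 m1 : W -> \bar R) (C : R) x y :
  ext_seminorm n0 -> ext_seminorm n1 -> ext_seminorm m0 -> ext_seminorm m1 ->
  0 < C -> (in_sum m0 m1 y -> in_sum n0 n1 x) ->
  (forall k : int, (K_functional n0 n1 (2%:R ^ k) x <=
     C%:E * K_functional m0 m1 (2%:R ^ k) y)%E) ->
  (K_method n0 n1 E x <= C%:E * K_method m0 m1 E y)%E.
Proof.
move=> s0 s1 sm0 sm1 C0 yx h; rewrite {2}/K_method.
case: asboolP => [/[dup] iny /yx inx|]; last by rewrite gt0_muley ?lte_fin// leey.
rewrite K_methodE// -[C in C%:E]gtr0_norm// -(seminormZ (lattice_seminorm E_lattice)).
apply: (lattice_le E_lattice) => k.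
rewrite [X in _ <= `|X|](_ : _ = C * K_sequence m0 m1 y k)//.
rewrite !ger0_norm ?mulr_ge0 ?K_sequence_ge0// ?(ltW C0)//.
by rewrite -lee_fin EFinM -!K_sequenceE.
Qed.

Section ordered_couple.
Context {V : lmodType R}.
Variables (Z : set V) (n0 n1 : V -> \bar R).
Hypotheses (s0 : ext_seminorm n0) (B1 : is_banach Z n1).
Variable c : R.
Hypothesis c0 : 0 < c.
Hypothesis n10 : forall x, (c%:E * n1 x <= n0 x)%E.

Let s1 : ext_seminorm n1 := banach_seminorm B1.
Local Notation K := (K_functional n0 n1).
Local Notation X := (K_method n0 n1 E).

Lemma in_space_dominated x : in_space n0 x -> in_space n1 x.
Proof.
rewrite /in_space => h; have := le_lt_trans (n10 x) h.
rewrite muleC -lte_pdivlMr// => /lt_le_trans; apply; exact: leey.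
Qed.

Lemma in_sum_ordered x : in_sum n0 n1 x <-> in_space n1 x.
Proof.
split=> [[x0 [x1 [-> /in_space_dominated h0 h1]]]|h].
  exact: (in_spaceD s1).
by exists 0, x; rewrite add0r; split=> //; exact: (in_space0 s0).
Qed.

Lemma K_functional_ub_ordered t x : in_space n1 x -> (K t x <= t%:E * n1 x)%E.
Proof.
move=> h; have := K_functional_ub t (in_space0 s0) h.
by rewrite add0r (seminorm0 s0) add0e.
Qed.

Lemma K_functional_lb_ordered t x : 0 < t ->
  ((Num.min c t)%:E * n1 x <= K t x)%E.
Proof.
move=> t0; have m0 : 0 <= Num.min c t by rewrite le_min !ltW.
apply: le_ereal_inf_tmp => _ [x0 [x1 [-> _ _ ->]]].
apply: le_trans (lee_wpmul2l _ (seminormD s1 _ _)) _; first by rewrite lee_fin.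
rewrite ge0_muleDr ?(seminorm_ge0 s1)//; apply: leeD.
  apply: le_trans (n10 _); apply: lee_wpmul2r; first exact: (seminorm_ge0 s1).
  by rewrite lee_fin ge_min lexx.
apply: lee_wpmul2r; first exact: (seminorm_ge0 s1).
by rewrite lee_fin ge_min lexx orbT.
Qed.

(** The coordinate at 0 of the K-sequence is K(1, x), which is comparable with
    the second norm because the first one dominates it. This is what makes a
    Cauchy sequence of the K-method converge somewhere. *)
Lemma K_method_dominates : exists2 C : R, 0 < C &
  forall x, (n1 x <= C%:E * X x)%E.
Proof.
have [C C0 hC] := lattice_coord E_lattice E_min 0.
have m0 : 0 < Num.min c 1 by rewrite lt_min c0 ltr01.
exists ((Num.min c 1)^-1 * C); first by rewrite mulr_gt0// invr_gt0.
move=> x; have Cp : 0 < (Num.min c 1)^-1 * C by rewrite mulr_gt0// invr_gt0.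
have [h|h] := asboolP (in_sum n0 n1 x); last first.
  by rewrite /K_method asboolF// gt0_muley ?lte_fin// leey.
rewrite K_methodE// EFinM -muleA -lee_pdivrMl ?invr_gt0// invrK.
apply: le_trans (K_functional_lb_ordered x ltr01) _.
rewrite -[1 : R](expr0z 2%:R) K_sequenceE//.
by rewrite -[X in X%:E]ger0_norm ?K_sequence_ge0//; exact: hC.
Qed.

Lemma K_method_ge0 x : (0 <= X x)%E.
Proof.
rewrite /K_method; case: asboolP => // _.
exact: (seminorm_ge0 (lattice_seminorm E_lattice)).
Qed.

Lemma K_method_seminorm : ext_seminorm X.
Proof.
have sE := lattice_seminorm E_lattice; split.
- exact: K_method_ge0.
- move=> a x; have [->|a0] := eqVneq a 0.
    rewrite scale0r normr0 mul0e K_methodE; last first.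
      by apply/in_sum_ordered; exact: (in_space0 s1).
    rewrite [X in E X](_ : _ = 0) ?(seminorm0 sE)//.
    apply/funext => k; rewrite /K_sequence; apply/eqP.
    rewrite [K_functional _ _ _ _](_ : _ = 0%E)//; apply/eqP; rewrite eq_le.
    rewrite (K_functional_ge0 _ s0 s1) ?exp2z_ge0// andbT.
    rewrite -[leRHS](mule0 (2%:R ^ k)%:E) -(seminorm0 s1).
    by apply: K_functional_ub_ordered; exact: (in_space0 s1).
  apply/eqP; rewrite eq_le.
  have na : 0 < `|a| by rewrite normr_gt0.
  have inZ y b : in_sum n0 n1 y -> in_sum n0 n1 (b *: y).
    move=> /in_sum_ordered h; apply/in_sum_ordered; rewrite /in_space.
    by rewrite (seminormZ s1) lte_mul_pinfty// lee_fin.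
  have KZ b y : b != 0 -> (X (b *: y) <= `|b|%:E * X y)%E.
    move=> b0; apply: le_K_method => //; first by rewrite normr_gt0.
      exact: inZ.
    by move=> k; rewrite K_functionalZ// exp2z_ge0.
  rewrite KZ//= muleC -lee_pdivlMr// muleC -normfV.
  apply: le_trans (KZ _ _ _); last by rewrite invr_eq0.
  by rewrite scalerA mulVf// scale1r.
- move=> x y.
  have [hx|hx] := asboolP (in_sum n0 n1 x); last first.
    rewrite [X in (_ <= X + _)%E]/K_method asboolF// addye ?leey//.
    by rewrite gt_eqF// (lt_le_trans _ (K_method_ge0 _)).
  have [hy|hy] := asboolP (in_sum n0 n1 y); last first.
    rewrite [X in (_ <= _ + X)%E]/K_method asboolF// addey ?leey//.
    by rewrite gt_eqF// (lt_le_trans _ (K_method_ge0 _)).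
  have hxy : in_sum n0 n1 (x + y).
    apply/in_sum_ordered; apply: (in_spaceD s1); exact/in_sum_ordered.
  rewrite !K_methodE//; apply: le_trans (seminormD sE _ _).
  apply: (lattice_le E_lattice) => k.
  rewrite [X in _ <= `|X|](_ : _ = K_sequence n0 n1 x k + K_sequence n0 n1 y k)//.
  rewrite !ger0_norm ?addr_ge0 ?K_sequence_ge0//.
  rewrite -lee_fin EFinD -!K_sequenceE// K_functionalD//.
  by rewrite exp2z_ge0.
Qed.

Lemma K_method_eq0 x : X x = 0%E <-> Z x.
Proof.
have sE := lattice_seminorm E_lattice.
have [_ n1Z _ _ _] := B1; split=> [X0|/n1Z nx].
  have [C C0 /(_ x)] := K_method_dominates; rewrite X0 mule0 => h.
  by apply/n1Z/eqP; rewrite eq_le h (seminorm_ge0 s1).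
rewrite K_methodE; last by apply/in_sum_ordered; rewrite /in_space nx ltry.
rewrite [X in E X](_ : _ = 0) ?(seminorm0 sE)//.
apply/funext => k; rewrite /K_sequence.
rewrite [K_functional _ _ _ _](_ : _ = 0%E)//; apply/eqP; rewrite eq_le.
rewrite (K_functional_ge0 _ s0 s1) ?exp2z_ge0// andbT.
have /(K_functional_ub_ordered (2%:R ^ k)) : in_space n1 x.
  by rewrite /in_space nx ltry.
by rewrite nx mule0.
Qed.

(** A Cauchy sequence has a limit l for the second norm. Along a fast
    subsequence v the K-sequences of the increments are summable in E; their sum
    S controls the K-sequence of l - v J through the tails S - s J, because
    K(2^k, .) is subadditive and continuous for the second norm. *)
Lemma K_method_complete (u : nat -> V) : (forall n, in_space X (u n)) ->
  (forall e : R, 0 < e -> exists N : nat,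
     forall m n, (N <= m)%N -> (N <= n)%N -> (X (u m - u n) < e%:E)%E) ->
  exists2 l, in_space X l & (X (u n - l) @[n --> \oo] --> 0)%E.
Proof.
move=> uX uC; have sX := K_method_seminorm.
have sE := lattice_seminorm E_lattice.
have [C C0 XC] := K_method_dominates.
have [_ _ _ _ n1c] := B1.
have [||l l1 lc] := n1c u.
- move=> n; rewrite /in_space; apply: le_lt_trans (XC _) _.
  by rewrite lte_mul_pinfty ?lee_fin ?ltW//; exact: uX.
- move=> e e0; have [|N hN] := uC (C^-1 * e); first by rewrite mulr_gt0// invr_gt0.
  exists N => m n Nm Nn; apply: le_lt_trans (XC _) _.
  by rewrite muleC -lte_pdivlMr// -EFinM mulrC hN.
have {}lc : forall e : R, 0 < e ->
    exists N, forall n, (N <= n)%N -> (n1 (u n - l) < e%:E)%E.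
  by apply/cvge0P => // n; exact: (seminorm_ge0 s1).
have [M [Mj MS hM]] := fast_cauchy_subsequence
  (fun j => exprn_gt0 j (half_gt0 R)) uC.
pose v j := u (M j); pose d j := v j.+1 - v j; pose kappa j := K_sequence n0 n1 (d j).
pose s J : int -> R := \sum_(j < J) kappa j.
have inX y : in_space X y -> in_sum n0 n1 y := @K_method_in_sum _ _ _ _.
have dX j : (X (d j) < ((2^-1 : R) ^+ j)%:E)%E.
  by apply: hM; exact: MS.
have d_sum j : in_sum n0 n1 (d j).
  by apply: inX; rewrite /in_space (lt_trans (dX j))// ltry.
have kappaE j : (E (kappa j) < ((2^-1 : R) ^+ j)%:E)%E.
  by rewrite -K_methodE.
have sE_cauchy m p : (E (s (m + p)%N - s m)%R <=
    (2 * 2^-1 ^+ m - 2 * 2^-1 ^+ (m + p))%:E)%E.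
  elim: p => [|p ih]; first by rewrite addn0 !subrr (seminorm0 sE).
  rewrite addnS /s big_ord_recr/= -/(s _) addrAC.
  apply: le_trans (seminormD sE _ _) _.
  apply: le_trans (leeD ih (ltW (kappaE _))) _.
  by rewrite -EFinD lee_fin exprS; lra.
have sE_cauchy' m n : (m <= n)%N -> (E (s n - s m)%R <= (2 * 2^-1 ^+ m)%:E)%E.
  move=> mn; rewrite -(subnKC mn); apply: le_trans (sE_cauchy _ _) _.
  by rewrite lee_fin gerBl mulr_ge0// exprn_ge0// invr_ge0.
have [_ _ _ _ Ec] := E_lattice.1.
have [||S S1 Sc] := Ec s.
- move=> n; rewrite /in_space; have := sE_cauchy' 0%N n (leq0n _).
  by rewrite /s big_ord0 subr0 => /le_lt_trans; apply; rewrite ltry.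
- move=> e e0; have [|N hN] := @half_expn_small R (e / 4); first by rewrite divr_gt0.
  exists N => m n Nm Nn; apply: le_lt_trans (seminorm_triangle sE (s N) _ _) _.
  rewrite [X in (_ + X)%E](seminormC sE).
  apply: le_lt_trans (leeD (sE_cauchy' _ _ Nm) (sE_cauchy' _ _ Nn)) _.
  by rewrite -EFinD lte_fin; have := hN N (leqnn N); lra.
have {}Sc : forall e : R, 0 < e ->
    exists N, forall n, (N <= n)%N -> (E (s n - S)%R < e%:E)%E.
  by apply/cvge0P => // n; exact: (seminorm_ge0 sE).
have Kv J p k : (K (2%:R ^ k) (l - v J) <= K (2%:R ^ k) (l - v (J + p)%N) +
    (s (J + p)%N k - s J k)%:E)%E.
  elim: p => [|p ih]; first by rewrite addn0 subrr adde0.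
  apply: le_trans ih _; rewrite addnS.
  have -> : l - v (J + p)%N = (l - v (J + p).+1) + d (J + p)%N.
    by rewrite /d addrA subrK.
  apply: le_trans (leeD2r _ (K_functionalD s0 s1 (exp2z_ge0 k) _ _)) _.
  rewrite -addeA leeD2l// (K_sequenceE k s0 s1 (d_sum _)) -EFinD lee_fin.
  have -> : s (J + p).+1 k = s (J + p)%N k + K_sequence n0 n1 (d (J + p)%N) k.
    by rewrite /s big_ord_recr.
  by lra.
have KS J k : (K (2%:R ^ k) (l - v J) <= (S k - s J k)%:E)%E.
  apply/lee_addgt0Pr => e e0.
  have [C1 C10 hC1] := lattice_coord E_lattice E_min k.
  have [|N1 hN1] := Sc (C1^-1 * (e / 2)); first by rewrite mulr_gt0 ?invr_gt0 ?divr_gt0.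
  have [|N2 hN2] := lc ((2%:R ^ k)^-1 * (e / 2)).
    by rewrite mulr_gt0 ?divr_gt0// invr_gt0 exp2z_gt0.
  pose p := maxn N1 N2.
  apply: le_trans (Kv J p k) _.
  have lv : (n1 (l - v (J + p)%N) < ((2%:R ^ k)^-1 * (e / 2))%:E)%E.
    rewrite (seminormC s1); apply: hN2; apply: leq_trans (Mj _).
    by rewrite (leq_trans (leq_maxr N1 N2))// leq_addl.
  have h1 : (K (2%:R ^ k) (l - v (J + p)%N) <= (e / 2)%:E)%E.
    apply: le_trans (K_functional_ub_ordered _ _) _.
      by rewrite /in_space (lt_trans lv)// ltry.
    by rewrite muleC -lee_pdivlMr ?exp2z_gt0// -EFinM mulrC ltW.
  have h2 : `|(s (J + p)%N - S) k| <= e / 2.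
    rewrite -lee_fin; apply: le_trans (hC1 _) _.
    rewrite muleC -lee_pdivlMr// -EFinM mulrC ltW//; apply: hN1.
    by rewrite (leq_trans (leq_maxl N1 N2))// leq_addl.
  apply: le_trans (leeD2r _ h1) _; rewrite -!EFinD lee_fin.
  move: h2; rewrite -[(s _ - S) k]/(s (J + p)%N k - S k) ler_norml.
  by move=> /andP[_ h2]; lra.
have lX J : (X (l - v J) <= E (s J - S)%R)%E.
  rewrite (seminormC sE) K_methodE; last first.
    apply/in_sum_ordered; apply: (in_spaceD s1) => //.
    rewrite /in_space (seminormN s1); apply/in_sum_ordered/inX; exact: uX.
  apply: (lattice_le E_lattice) => k; rewrite ger0_norm ?K_sequence_ge0//.
  apply: le_trans (ler_norm _); rewrite -lee_fin -K_sequenceE//.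
  apply/in_sum_ordered; apply: (in_spaceD s1) => //.
  rewrite /in_space (seminormN s1); apply/in_sum_ordered/inX; exact: uX.
exists l.
  rewrite -(subrK (v 0%N) l); apply: (in_spaceD sX); last exact: uX.
  rewrite /in_space (le_lt_trans (lX 0%N))//; apply: (in_spaceD sE).
    by rewrite /s big_ord0; exact: in_space0.
  by rewrite /in_space (seminormN sE).
apply/cvge0P => [n|e e0]; first exact: K_method_ge0.
have [|N1 hN1] := Sc (e / 2); first by rewrite divr_gt0.
have [|N2 hN2] := @half_expn_small R (e / 2); first by rewrite divr_gt0.
pose J := maxn N1 N2; exists (M J) => n Nn.
apply: le_lt_trans (seminorm_triangle sX (v J) _ _) _.
have -> : e = e / 2 + e / 2 by lra.
rewrite EFinD (seminormC sX (v J)); apply: lteD.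
  apply: lt_le_trans (hM J _ Nn) _.
  by rewrite lee_fin ltW// hN2// leq_maxr.
by apply: le_lt_trans (lX J) _; rewrite hN1// leq_maxl.
Qed.

Lemma K_method_banach : is_banach Z X.
Proof.
have [h1 h2 h3] := K_method_seminorm.
split=> //; [exact: K_method_eq0|exact: K_method_complete].
Qed.

End ordered_couple.
End K_method_theory.

(** * Pointwise limits of measurable functions *)

Section pointwise_limits.
Context {R : realType}.

Lemma invS_small (e : R) : 0 < e -> exists k : nat, k.+1%:R^-1 < e.
Proof.
move=> e0; have [N _ hN] := near_infty_natSinv_lt (PosNum e0).
by exists N; apply: hN => /=.
Qed.

(** Cauchy's criterion with countable quantifiers only, so that it can be read
    off measurable sets. *)
Lemma cvgn_cauchyP (u : nat -> R) : cvgn u <->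
  forall k : nat, exists N, forall n, (N <= n)%N -> `|u n - u N| <= k.+1%:R^-1.
Proof.
split=> [/cvg_ex[l /cvgrPdist_le ul] k|h].
  have [|N _ hN] := ul (k.+1%:R^-1 / 2); first by rewrite divr_gt0 ?invr_gt0.
  exists N => n Nn; have h1 := hN n Nn; have h2 := hN N (leqnn N).
  apply: le_trans (ler_distD l _ _) _; rewrite distrC in h1.
  by apply: le_trans (lerD h1 h2) _; rewrite -splitr.
apply/cauchy_cvgP/cauchy_exP => e e0.
have [k ke] := invS_small e0; have [N hN] := h k.
exists (u N); exists N => // n /= Nn.
by rewrite -ball_normE /= distrC (le_lt_trans (hN n Nn)).
Qed.

(** The set of convergence is measurable by Cauchy's criterion, and outside of it
    [limn] takes a constant default value. *)
Lemma measurable_limn d (T : measurableType d) (D : set T)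
    (f : nat -> T -> R) : measurable D ->
  (forall n, measurable_fun D (f n)) ->
  measurable_fun D (fun t => limn (f^~ t)).
Proof.
move=> mD mf.
pose C := \bigcap_k \bigcup_N \bigcap_(n in [set n | (N <= n)%N])
  (D `&` [set t | `|f n t - f N t| <= k.+1%:R^-1]).
have mC : measurable C.
  apply: bigcapT_measurable => k; apply: bigcupT_measurable => N.
  apply: bigcap_measurable; first by exists N => /=.
  move=> n _; rewrite -[X in _ `&` X](_ :
    (fun t => `|f n t - f N t| <= k.+1%:R^-1) @^-1` [set true] = _)//.
  apply: measurable_fun_ler => //; apply: measurableT_comp => //.
  exact: measurable_funB.
have CE t : C t <-> D t /\ cvgn (f^~ t).
  split=> [Ct|[Dt /cvgn_cauchyP ct] k _].
    split; first by have [N _ /(_ N (leqnn N))[]] := Ct 0%N I.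
    apply/cvgn_cauchyP => k; have [N _ hN] := Ct k I.
    by exists N => n /hN[].
  by have [N hN] := ct k; exists N => // n /= /hN.
have CD : C `<=` D by move=> t /CE[].
have -> : D = C `|` (D `\` C) by rewrite setDUK.
apply/measurable_funU => //; first exact: measurableD.
split.
  apply: (@measurable_fun_cvg _ _ _ _ f) => [n|t /CE[_ ct]].
    exact: measurable_funS (mf n).
  exact: ct.
apply: (@eq_measurable_fun _ _ _ _ _ (cst point)) => //.
move=> t; rewrite inE => -[Dt nCt] /=.
rewrite /lim /lim_in xgetPN//= => l ul; apply: nCt; apply/CE; split => //.
by apply/cvg_ex; exists l.
Qed.

End pointwise_limits.

(** * The unit interval and the space of bounded functions *)

Section unit_interval.
Context {R : realType}.
Local Notation mu := (@lebesgue_measure R).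
Local Notation I01 := (`[0%R, 1%R]%classic : set R).

Lemma measurable_I01 : measurable I01. Proof. exact: measurable_itv. Qed.

Lemma lebesgue_measure_I01 : mu I01 = 1%E.
Proof. by rewrite lebesgue_measure_itv/= lte_fin ltr01 oppr0 adde0. Qed.

Lemma lebesgue_measureT_gt0 : (0 < mu [set: R])%E.
Proof.
rewrite (@lt_le_trans _ _ 1%E)// -lebesgue_measure_I01.
by rewrite le_measure ?inE//; exact: measurable_I01.
Qed.

Lemma aeW (P : R -> Prop) : (forall t, P t) -> {ae mu, forall t, P t}.
Proof. by move=> h; have F := ae_filter_ringOfSetsType mu; exact: nearW. Qed.

Lemma aeS (P Q : R -> Prop) : (forall t, P t -> Q t) ->
  {ae mu, forall t, P t} -> {ae mu, forall t, Q t}.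
Proof. by move=> h hP; have F := ae_filter_ringOfSetsType mu; exact: filterS hP. Qed.

Lemma aeS2 (P Q S : R -> Prop) : (forall t, P t -> Q t -> S t) ->
  {ae mu, forall t, P t} -> {ae mu, forall t, Q t} -> {ae mu, forall t, S t}.
Proof.
by move=> h hP hQ; have F := ae_filter_ringOfSetsType mu; exact: filterS2 hP hQ.
Qed.

End unit_interval.

Section seminorm_criterion.
Context {R : realType} {V : lmodType R}.

(** It suffices to bound norms above: applied to the inverse scalar, one
    inequality of homogeneity gives the other, and finite values are enough for
    the triangle inequality. *)
Lemma ext_seminorm_criterion (n : V -> \bar R) :
  (forall x, 0 <= n x)%E -> n 0 = 0%E ->
  (forall (c : R) x, c != 0%R -> n (c *: x)%R <= `|c|%:E * n x)%E ->
  (forall x y (a b : R), n x <= a%:E -> n y <= b%:E ->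
     n (x + y)%R <= (a + b)%:E)%E ->
  ext_seminorm n.
Proof.
move=> n_ge0 n0 nZ nD; split=> //.
- move=> c x; have [->|c0] := eqVneq c 0.
    by rewrite scale0r n0 normr0 mul0e.
  apply/eqP; rewrite eq_le nZ//= muleC -lee_pdivlMr ?normr_gt0// muleC -normfV.
  apply: le_trans (nZ _ _ _); last by rewrite invr_eq0.
  by rewrite scalerA mulVf// scale1r.
- move=> x y.
  have [hx|] := ltP (n x) +oo%E; last first.
    rewrite leye_eq => /eqP ->; rewrite addye ?leey//.
    by rewrite gt_eqF// (lt_le_trans _ (n_ge0 y)).
  have [hy|] := ltP (n y) +oo%E; last first.
    rewrite leye_eq => /eqP ->; rewrite addey ?leey//.
    by rewrite gt_eqF// (lt_le_trans _ (n_ge0 x)).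
  rewrite (ge0_lty_fin (n_ge0 x) hx) (ge0_lty_fin (n_ge0 y) hy) -EFinD.
  by apply: nD; rewrite -ge0_lty_fin.
Qed.

End seminorm_criterion.

Section Linfty.
Context {R : realType}.
Local Notation mu := (@lebesgue_measure R).
Local Notation I01 := (`[0%R, 1%R]%classic : set R).
Implicit Types x y : R -> R.

Lemma Linfty_leP x M : measurable_fun I01 x -> 0 <= M ->
  (Linfty_norm x <= M%:E)%E <->
  {ae mu, forall t, I01 t -> `|x t| <= M}.
Proof.
move=> mx M0; rewrite /Linfty_norm asboolT// unlock lebesgue_measureT_gt0.
have E t : ((abse \o (EFin \o x \_ I01)) t <= M%:E)%E <->
    (I01 t -> `|x t| <= M).
  rewrite /= lee_fin patchE; case: ifPn => [|/negP].
    by rewrite inE => It; split => // /(_ It).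
  by rewrite inE normr0 => nIt; split => // _ /nIt.
split=> [/ess_supP|h].
  by apply: aeS => t /E.
by apply/ess_supP; apply: aeS h => t /E.
Qed.

Lemma Linfty_measurable x : in_space Linfty_norm x -> measurable_fun I01 x.
Proof. by rewrite /in_space /Linfty_norm; case: asboolP; rewrite ?ltxx. Qed.

Lemma Linfty_ge0 x : (0 <= Linfty_norm x)%E.
Proof. by rewrite /Linfty_norm; case: asboolP => // _; exact: Lnorm_ge0. Qed.

Lemma Linfty_ae_bound x : in_space Linfty_norm x ->
  {ae mu, forall t, I01 t -> `|x t| <= fine (Linfty_norm x)}.
Proof.
move=> /[dup] xi /Linfty_measurable mx; have x0 := Linfty_ge0 x.
by apply/Linfty_leP; rewrite ?fine_ge0// -ge0_lty_fin.
Qed.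

Lemma Linfty_seminorm : ext_seminorm (@Linfty_norm R).
Proof.
apply: ext_seminorm_criterion.
- exact: Linfty_ge0.
- apply/eqP; rewrite eq_le Linfty_ge0 andbT; apply/Linfty_leP => //.
    exact: measurable_cst.
  by apply: aeW => t _ /=; rewrite normr0.
- move=> c x c0; have [xi|] := ltP (Linfty_norm x) +oo%E; last first.
    by rewrite leye_eq => /eqP->; rewrite gt0_muley ?leey// lte_fin normr_gt0.
  have xb := Linfty_ae_bound xi; have mx := Linfty_measurable xi.
  rewrite (ge0_lty_fin (Linfty_ge0 x) xi) -EFinM; apply/Linfty_leP.
  + by apply: measurable_funM => //; exact: measurable_cst.
  + by rewrite mulr_ge0// fine_ge0// Linfty_ge0.
  apply: aeS xb => t /[apply] xb.
  by rewrite -[(c *: x) t]/(c * x t) normrM ler_wpM2l.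
- move=> x y a b xa yb.
  have xi : in_space Linfty_norm x by rewrite /in_space (le_lt_trans xa)// ltry.
  have yi : in_space Linfty_norm y by rewrite /in_space (le_lt_trans yb)// ltry.
  have mx := Linfty_measurable xi; have my := Linfty_measurable yi.
  have a0 : 0 <= a by rewrite -lee_fin (le_trans (Linfty_ge0 x)).
  have b0 : 0 <= b by rewrite -lee_fin (le_trans (Linfty_ge0 y)).
  move: xa yb => /(Linfty_leP mx a0) xa /(Linfty_leP my b0) yb.
  apply/Linfty_leP; rewrite ?addr_ge0//; first exact: measurable_funD.
  apply: aeS2 xa yb => t xa yb It.
  by apply: le_trans (ler_normD _ _) _; rewrite lerD ?xa ?yb.
Qed.

End Linfty.

(** * The Orlicz space of exp(t^2) - 1 *)

Section gauss_young_function.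
Context {R : realType}.
Implicit Types a b u v : R.

Definition gauss_young (a : R) : R := expR (a ^+ 2) - 1.

Lemma gauss_young_ge0 a : 0 <= gauss_young a.
Proof. by rewrite subr_ge0 -expR0 ler_expR sqr_ge0. Qed.

Lemma gauss_young0 : gauss_young 0 = 0.
Proof. by rewrite /gauss_young expr0n/= expR0 subrr. Qed.

Lemma gauss_young_le a b : 0 <= a -> a <= b -> gauss_young a <= gauss_young b.
Proof.
move=> a0 ab; rewrite lerB// ler_expR.
by rewrite -subr_ge0 subr_sqr mulr_ge0 ?subr_ge0// addr_ge0// (le_trans a0).
Qed.

Lemma le_gauss_young a : a <= gauss_young a + 1.
Proof.
rewrite /gauss_young subrK; apply: le_trans (expR_ge1Dx _).
by have := sqr_ge0 (a - 2^-1); rewrite sqrrB; lra.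
Qed.

Lemma expR_convex_weights (p q s t : R) : 0 <= p -> 0 <= q -> p + q = 1 ->
  expR (p * s + q * t) <= p * expR s + q * expR t.
Proof.
move=> p0 q0 pq; set m := p * s + q * t.
have tangent r : expR m * (1 + (r - m)) <= expR r.
  have -> : expR r = expR m * expR (r - m) by rewrite -expRD addrC subrK.
  by rewrite ler_pM2l ?expR_gt0// expR_ge1Dx.
apply: le_trans (lerD (ler_wpM2l p0 (tangent s)) (ler_wpM2l q0 (tangent t))).
have -> : p * (expR m * (1 + (s - m))) + q * (expR m * (1 + (t - m))) =
  expR m * ((p + q) * (1 - m) + m) by rewrite /m; ring.
by rewrite pq mul1r subrK mulr1.
Qed.

(** Convexity of the Young function, in the form needed for the triangle
    inequality of its Luxemburg norm. *)
Lemma gauss_young_convex a b u v : 0 < u -> 0 < v ->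
  gauss_young ((a + b) / (u + v)) <=
  u / (u + v) * gauss_young (a / u) + v / (u + v) * gauss_young (b / v).
Proof.
move=> u0 v0; have uv0 : 0 < u + v by rewrite addr_gt0.
set p := u / (u + v); set q := v / (u + v).
have p0 : 0 <= p by rewrite divr_ge0 ?ltW.
have q0 : 0 <= q by rewrite divr_ge0 ?ltW.
have pq : p + q = 1 by rewrite -mulrDl divff// gt_eqF.
rewrite !mulrBr !mulr1 addrACA -opprD pq lerB//.
apply: le_trans (expR_convex_weights _ _ p0 q0 pq); rewrite ler_expR.
have -> : (a + b) / (u + v) = p * (a / u) + q * (b / v).
  by rewrite /p /q; field; rewrite !gt_eqF.
have -> : q = 1 - p by rewrite -pq addrAC subrr add0r.
rewrite -subr_ge0.
set r := a / u; set s := b / v.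
have -> : p * r ^+ 2 + (1 - p) * s ^+ 2 - (p * r + (1 - p) * s) ^+ 2 =
  p * (1 - p) * (r - s) ^+ 2 by ring.
apply: mulr_ge0; last exact: sqr_ge0.
by apply: mulr_ge0 => //; rewrite -pq addrAC subrr add0r.
Qed.

End gauss_young_function.

Section Orlicz.
Context {R : realType}.
Local Notation mu := (@lebesgue_measure R).
Local Notation I01 := (`[0%R, 1%R]%classic : set R).
Implicit Types x y : R -> R.

Definition gauss_modular x (u : R) : \bar R :=
  (\int[mu]_(t in I01) (gauss_young (`|x t| / u))%:E)%E.

Lemma measurable_gauss_young x u : measurable_fun I01 x ->
  measurable_fun I01 (fun t => (gauss_young (`|x t| / u))%:E).
Proof.
move=> mx; apply/measurable_EFinP; apply: measurable_funB => //.
apply: (measurableT_comp (@measurable_expR R)); apply: measurable_funX.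
apply: measurable_funM => //; exact: measurableT_comp.
Qed.

Lemma gauss_modular_le x y u v : measurable_fun I01 x -> measurable_fun I01 y ->
  0 < u ->
  {ae mu, forall t, I01 t -> `|x t| / u <= `|y t| / v} ->
  (gauss_modular x u <= gauss_modular y v)%E.
Proof.
move=> mx my u0 h; apply: ae_ge0_le_integral.
- exact: measurable_I01.
- by move=> t _; rewrite lee_fin gauss_young_ge0.
- exact: measurable_gauss_young.
- by move=> t _; rewrite lee_fin gauss_young_ge0.
- exact: measurable_gauss_young.
apply: aeS h => t /[apply] h; rewrite lee_fin gauss_young_le//.
by rewrite divr_ge0// ltW.
Qed.

Lemma LN_measurable x : in_space LN_norm x -> measurable_fun I01 x.
Proof. by rewrite /in_space /LN_norm/orlicz_norm; case: asboolP; rewrite ?ltxx. Qed.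

Lemma LN_le_modular x u : measurable_fun I01 x -> 0 < u ->
  (gauss_modular x u <= 1)%E -> (LN_norm x <= u%:E)%E.
Proof.
move=> mx u0 h; rewrite /LN_norm /orlicz_norm asboolT//.
by apply: ereal_inf_lbound; exists u.
Qed.

Lemma LN_ge0 x : (0 <= LN_norm x)%E.
Proof.
rewrite /LN_norm /orlicz_norm; case: asboolP => // mx.
by apply: le_ereal_inf_tmp => _ [u [u0 _] <-]; rewrite lee_fin ltW.
Qed.

Lemma LN_lt_modular x u : (LN_norm x < u%:E)%E ->
  [/\ measurable_fun I01 x, 0 < u & (gauss_modular x u <= 1)%E].
Proof.
move=> xu; have u0 : 0 < u by rewrite -lte_fin (le_lt_trans (LN_ge0 x)).
have mx : measurable_fun I01 x.
  by apply: LN_measurable; rewrite /in_space (lt_trans xu)// ltry.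
split=> //; move: xu; rewrite /LN_norm /orlicz_norm asboolT//.
move=> /ereal_inf_lt[_ [v [v0 hv] <-]]; rewrite lte_fin => vu.
apply: le_trans (gauss_modular_le _ _ _ _) hv => //.
by apply: aeW => t _; rewrite ler_wpM2l// lef_pV2 ?posrE// ltW.
Qed.

(** The infimum defining the norm need not be tested at the bound itself. *)
Lemma LN_le_of_gt x u : 0 <= u -> measurable_fun I01 x ->
  (forall v, u < v -> (gauss_modular x v <= 1)%E) -> (LN_norm x <= u%:E)%E.
Proof.
move=> u0 mx h; apply: lee_of_ltR => v; rewrite lte_fin => uv.
by apply: LN_le_modular => //; [exact: le_lt_trans uv|exact: h].
Qed.

Lemma LN_monotone x y : measurable_fun I01 x -> measurable_fun I01 y ->
  {ae mu, forall t, I01 t -> `|x t| <= `|y t|} -> (LN_norm x <= LN_norm y)%E.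
Proof.
move=> mx my h; apply: lee_of_ltR => v /LN_lt_modular[_ v0 hv].
apply: (LN_le_modular mx v0).
apply: le_trans (gauss_modular_le mx my v0 _) hv.
by apply: aeS h => t /[apply] h; rewrite ler_wpM2r// invr_ge0 ltW.
Qed.

Lemma LN_ae_eq x y : measurable_fun I01 x -> measurable_fun I01 y ->
  {ae mu, forall t, I01 t -> x t = y t} -> LN_norm x = LN_norm y.
Proof.
move=> mx my h; apply/le_anti/andP; split.
  by apply: (LN_monotone mx my); apply: aeS h => t /[apply] ->.
by apply: (LN_monotone my mx); apply: aeS h => t /[apply] ->.
Qed.

Lemma LN_ae_eq0 x : measurable_fun I01 x ->
  {ae mu, forall t, I01 t -> x t = 0} -> LN_norm x = 0%E.
Proof.
move=> mx h; apply/eqP; rewrite eq_le LN_ge0 andbT.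
apply: LN_le_of_gt => // v v0.
rewrite /gauss_modular (@ge0_ae_eq_integral _ _ _ mu I01 _ (cst 0%E)).
- by rewrite integral0.
- exact: measurable_I01.
- exact: measurable_gauss_young.
- exact: measurable_cst.
- by move=> t _; rewrite lee_fin gauss_young_ge0.
- by [].
by apply: aeS h => t /[apply] ->; rewrite normr0 mul0r gauss_young0.
Qed.

Lemma LN_scale_le c x : c != 0 -> (LN_norm (c *: x)%R <= `|c|%:E * LN_norm x)%E.
Proof.
move=> c0; have nc : 0 < `|c| by rewrite normr_gt0.
rewrite muleC -lee_pdivrMr//; apply: lee_of_ltR => v /LN_lt_modular[mx v0 hv].
rewrite lee_pdivrMr// -EFinM; apply: LN_le_modular.
- by apply: measurable_funM => //; exact: measurable_cst.
- by rewrite mulr_gt0.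
apply: le_trans hv; apply: gauss_modular_le => //.
- by apply: measurable_funM => //; exact: measurable_cst.
- by rewrite mulr_gt0.
apply: aeW => t _; rewrite -[(c *: x) t]/(c * x t) normrM.
by rewrite le_eqVlt; apply/orP; left; apply/eqP; field; rewrite !gt_eqF.
Qed.

Lemma LN_triangle x y a b : (LN_norm x <= a%:E)%E -> (LN_norm y <= b%:E)%E ->
  (LN_norm (x + y)%R <= (a + b)%:E)%E.
Proof.
move=> xa yb; apply: lee_of_ltR => r; rewrite lte_fin => abr.
pose e := (r - (a + b)) / 2.
have e0 : 0 < e by rewrite divr_gt0// subr_gt0.
have [|mx u0 hx] := @LN_lt_modular x (a + e).
  by rewrite (le_lt_trans xa)// lte_fin ltrDl.
have [|my v0 hy] := @LN_lt_modular y (b + e).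
  by rewrite (le_lt_trans yb)// lte_fin ltrDl.
have -> : r = (a + e) + (b + e) by rewrite /e; lra.
set u := a + e in u0 hx *; set v := b + e in v0 hy *.
have uv0 : 0 < u + v by rewrite addr_gt0.
have mxy : measurable_fun I01 (x + y) by exact: measurable_funD.
apply: (LN_le_modular mxy uv0).
have p0 : 0 <= u / (u + v) by rewrite divr_ge0 ?ltW.
have q0 : 0 <= v / (u + v) by rewrite divr_ge0 ?ltW.
apply: (@le_trans _ _ ((u / (u + v))%:E * gauss_modular x u +
  (v / (u + v))%:E * gauss_modular y v)%E); last first.
  apply: (@le_trans _ _ ((u / (u + v))%:E * 1 + (v / (u + v))%:E * 1)%E).
    by apply: leeD; apply: lee_wpmul2l => //; rewrite lee_fin.
  by rewrite !mule1 -EFinD lee_fin -mulrDl divff// gt_eqF.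
have mI := @measurable_I01 R.
have mGx := measurable_gauss_young u mx.
have mGy := measurable_gauss_young v my.
have Gx0 t : I01 t -> (0 <= (gauss_young (`|x t| / u))%:E)%E.
  by rewrite lee_fin gauss_young_ge0.
have Gy0 t : I01 t -> (0 <= (gauss_young (`|y t| / v))%:E)%E.
  by rewrite lee_fin gauss_young_ge0.
rewrite /gauss_modular -ge0_integralZl_EFin// -ge0_integralZl_EFin//.
rewrite -ge0_integralD//; last 4 first.
- by move=> t _; rewrite mule_ge0 ?lee_fin ?gauss_young_ge0.
- exact: measurable_funeM.
- by move=> t _; rewrite mule_ge0 ?lee_fin ?gauss_young_ge0.
- exact: measurable_funeM.
apply: ge0_le_integral => //.
- by move=> t _; rewrite lee_fin gauss_young_ge0.
- by apply: measurable_gauss_young; exact: measurable_funD.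
- by apply: emeasurable_funD; exact: measurable_funeM.
move=> t _; rewrite -!EFinM -EFinD lee_fin.
apply: le_trans (gauss_young_convex _ _ u0 v0).
apply: gauss_young_le; first by rewrite divr_ge0 ?(ltW uv0).
by rewrite ler_wpM2r ?invr_ge0 ?(ltW uv0)// ler_normD.
Qed.

Lemma LN_seminorm : ext_seminorm (@LN_norm R).
Proof.
apply: ext_seminorm_criterion.
- exact: LN_ge0.
- by apply: LN_ae_eq0; [exact: measurable_cst|exact: aeW].
- exact: LN_scale_le.
- exact: LN_triangle.
Qed.

End Orlicz.

(** * Completeness of the Orlicz space *)

Section Orlicz_completeness.
Context {R : realType}.
Local Notation mu := (@lebesgue_measure R).
Local Notation I01 := (`[0%R, 1%R]%classic : set R).
Implicit Types x y : R -> R.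

Definition null_on_I01 : set (R -> R) :=
  [set x : R -> R | measurable_fun I01 x /\ {ae mu, forall t, I01 t -> x t = 0}].

Lemma L1_le_modular x u : measurable_fun I01 x -> 0 < u ->
  (gauss_modular x u <= 1)%E ->
  (\int[mu]_(t in I01) `|x t|%:E <= (2 * u)%:E)%E.
Proof.
move=> mx u0 hx; have mI := @measurable_I01 R.
have mG := measurable_gauss_young u mx.
apply: (@le_trans _ _ (u%:E *
    \int[mu]_(t in I01) ((gauss_young (`|x t| / u))%:E + (cst 1%E) t))%E).
  rewrite -ge0_integralZl_EFin//; last 3 first.
  - by move=> t _; rewrite adde_ge0// lee_fin gauss_young_ge0.
  - by apply: emeasurable_funD => //.
  - exact: ltW.
  apply: ge0_le_integral => //.
  - by apply/measurable_EFinP; exact: measurableT_comp.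
  - by apply: measurable_funeM; apply: emeasurable_funD.
  move=> t _; rewrite /= -EFinD -EFinM lee_fin -ler_pdivrMl// mulrC.
  exact: le_gauss_young.
rewrite ge0_integralD//; last first.
  by move=> t _; rewrite lee_fin gauss_young_ge0.
rewrite integral_cst//= lebesgue_measure_I01 mule1 mulrC EFinM.
by rewrite lee_wpmul2l ?lee_fin ?(ltW u0)// -[2%R](natrD _ 1 1) EFinD leeD2r.
Qed.

Lemma LN_eq0 x : LN_norm x = 0%E <-> null_on_I01 x.
Proof.
split=> [x0|[mx x0]]; last exact: LN_ae_eq0.
have mx : measurable_fun I01 x by apply: LN_measurable; rewrite /in_space x0.
split=> //.
have : (\int[mu]_(t in I01) `|(x t)%:E| = 0)%E.
  apply/eqP; rewrite eq_le integral_ge0// andbT.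
  apply/lee_addgt0Pr => e e0; rewrite add0e.
  have [|_ e20 he] := @LN_lt_modular _ x (e / 2).
    by rewrite x0 lte_fin divr_gt0.
  have := L1_le_modular mx e20 he.
  by rewrite mulrC divfK.
move/ae_eq_integral_abs => /(_ (measurable_I01)).
move=> /(_ ((measurable_EFinP _ _).2 mx)).
by apply: aeS => t h It; have [] := h It.
Qed.

Lemma cvg_gauss_young (f : nat -> R) (a u : R) : f @ \oo --> a ->
  (fun n => gauss_young (`|f n| / u)) @ \oo --> gauss_young (`|a| / u).
Proof.
move=> fa.
have fu : (fun n => `|f n| / u) @ \oo --> `|a| / u.
  by apply: cvgMr_tmp; exact: cvg_norm.
have fu2 : (fun n => (`|f n| / u) ^+ 2) @ \oo --> (`|a| / u) ^+ 2.
  by rewrite expr2; under eq_fun do rewrite expr2; exact: cvgM.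
have fe : (fun n => expR ((`|f n| / u) ^+ 2)) @ \oo --> expR ((`|a| / u) ^+ 2).
  exact: continuous_cvg _ (@continuous_expR R _) fu2.
by apply: cvgB => //; exact: cvg_cst.
Qed.

(** Fatou's lemma: the unit balls of the Orlicz space are closed under almost
    everywhere convergence. *)
Lemma gauss_modular_fatou (f : nat -> R -> R) x u :
  (forall n, measurable_fun I01 (f n)) -> measurable_fun I01 x ->
  {ae mu, forall t, I01 t -> f n t @[n --> \oo] --> x t} ->
  (forall n, gauss_modular (f n) u <= 1)%E -> (gauss_modular x u <= 1)%E.
Proof.
move=> mf mx fx f1.
have mI := @measurable_I01 R.
pose g n t := (gauss_young (`|f n t| / u))%:E.
have g0 n t : I01 t -> (0 <= g n t)%E by rewrite lee_fin gauss_young_ge0.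
have mg n : measurable_fun I01 (g n) by exact: measurable_gauss_young.
apply: (@le_trans _ _ (\int[mu]_(t in I01) limn_einf (g^~ t))%E).
  apply: ae_ge0_le_integral => //.
  - by move=> t _; rewrite lee_fin gauss_young_ge0.
  - exact: measurable_gauss_young.
  - move=> t It; rewrite limn_einf_lim; apply: lime_ge; first exact: is_cvg_einfs.
    by apply: nearW => n; apply: le_ereal_inf_tmp => _ [m _ <-]; exact: g0.
  - rewrite /limn_einf; apply: measurableT_comp => //.
    apply: (@measurable_fun_limn_esup _ _ _ _ (fun n t => - g n t)%E) => n.
    exact: measurableT_comp.
  apply: aeS fx => t /[apply] fx.
  have : g n t @[n --> \oo] --> (gauss_young (`|x t| / u))%:E.
    by apply: cvg_EFin; [exact: nearW|exact: cvg_gauss_young].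
  by move=> /cvg_limn_einf_sup[-> _].
apply: le_trans (fatou mu mI mg g0) _.
rewrite limn_einf_lim; apply: lime_le; first exact: is_cvg_einfs.
apply: nearW => n; apply: le_trans (f1 n); apply: ereal_inf_lbound.
by exists n => /=.
Qed.

(** The sum of the absolute increments is integrable, hence finite almost
    everywhere, and there the increments form an absolutely convergent series. *)
Lemma L1_fast_cvg (v : nat -> R -> R) :
  (forall j, measurable_fun I01 (v j)) ->
  (forall j, (\int[mu]_(t in I01) `|v j.+1 t - v j t|%:E <=
     (2 / (2 ^ j.+1)%:R)%:E)%E) ->
  {ae mu, forall t, I01 t -> cvgn (v^~ t)}.
Proof.
move=> mv hv; have mI := @measurable_I01 R.
pose D j t := (`|v j.+1 t - v j t|%:E)%E.
have D0 j t : I01 t -> (0 <= D j t)%E by rewrite lee_fin.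
have mD j : measurable_fun I01 (D j).
  apply/measurable_EFinP; apply: measurableT_comp => //; exact: measurable_funB.
have S0 t : I01 t -> (0 <= \sum_(j <oo) D j t)%E.
  by move=> It; apply: nneseries_ge0 => n _ _; exact: D0.
have : mu.-integrable I01 (fun t => \sum_(j <oo) D j t)%E.
  apply/integrableP; split.
    apply: (eq_measurable_fun (fun t => \sum_(j <oo | j \in xpredT) D j t)%E).
      by move=> t _; exact: eq_eseriesl.
    apply: ge0_emeasurable_sum => [k t It _|k _]; [exact: D0|exact: mD].
  have -> : (\int[mu]_(t in I01) `|\sum_(j <oo) D j t| =
      \int[mu]_(t in I01) \sum_(j <oo) D j t)%E.
    by apply: eq_integral => t; rewrite inE => It; rewrite gee0_abs// S0.
  rewrite integral_nneseries//.
  apply: (@le_lt_trans _ _ (\sum_(j <oo) (2 / (2 ^ j.+1)%:R)%:E)%E).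
    apply: lee_nneseries => [j _ _|j _]; last exact: hv.
    by apply: integral_ge0 => t; exact: D0.
  by apply: le_lt_trans (epsilon_trick0 xpredT _) _ => //; rewrite ltry.
move/integrable_ae => /(_ mI); apply: aeS => t /[apply] fin.
have -> : v^~ t = (fun n => series (telescope (v^~ t)) n + v 0%N t).
  by apply/funext => n; rewrite telescopeK /= subrK.
apply: is_cvgD; last exact: is_cvg_cst.
apply: normed_cvg; apply: nondecreasing_is_cvgn.
  by apply: nondecreasing_series => n _ _; exact: normr_ge0.
exists (fine (\sum_(j <oo) D j t)%E) => _ [n _ <-].
rewrite -lee_fin fineK// /normed_series_of /series/= -sumEFin.
by apply: nneseries_lim_ge => k _ _; rewrite lee_fin.
Qed.

(** A fast subsequence converges almost everywhere, since the L_1 norm is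
    dominated by the Orlicz norm; Fatou's lemma turns the pointwise limit into a
    limit for the norm. *)
Lemma LN_complete (u : nat -> R -> R) : (forall n, in_space LN_norm (u n)) ->
  (forall e : R, 0 < e -> exists N : nat, forall m n, (N <= m)%N ->
     (N <= n)%N -> (LN_norm (u m - u n)%R < e%:E)%E) ->
  exists2 l, in_space LN_norm l & (LN_norm (u n - l)%R @[n --> \oo] --> 0)%E.
Proof.
move=> uN uC; have sN := @LN_seminorm R.
have [M [Mj MS hM]] := @fast_cauchy_subsequence _ _ _ u
  (fun j => ((2 ^ j.+1)%:R)^-1) (fun j => ltac:(by rewrite invr_gt0 ltr0n expn_gt0)) uC.
pose v j := u (M j).
have mu_ n : measurable_fun I01 (u n) by apply: LN_measurable.
have mv j : measurable_fun I01 (v j) by exact: mu_.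
have vcv : {ae mu, forall t, I01 t -> cvgn (v^~ t)}.
  apply: L1_fast_cvg => // j; have /LN_lt_modular[m1 d0 h1] := hM j _ (MS j).
  exact: L1_le_modular m1 d0 h1.
pose l t := limn (v^~ t).
have ml : measurable_fun I01 l by apply: measurable_limn => //; exact: measurable_I01.
have vl : {ae mu, forall t, I01 t -> v n t @[n --> \oo] --> l t}.
  by apply: aeS vcv => t /[apply].
have tail e : 0 < e -> exists N : nat, forall n, (N <= n)%N ->
    (LN_norm (u n - l)%R <= e%:E)%E.
  move=> e0; have [N hN] := uC e e0; exists N => n Nn.
  rewrite (seminormC sN); apply: LN_le_modular => //; first exact: measurable_funB.
  apply: (@gauss_modular_fatou (fun j => v (j + N)%N - u n)).
  - by move=> j; exact: measurable_funB.
  - exact: measurable_funB.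
  - apply: aeS vl => t /[apply] vl.
    apply: cvgB; last exact: cvg_cst.
    by have := vl; rewrite -(cvg_shiftn N).
  move=> j; have [] // := @LN_lt_modular _ (v (j + N)%N - u n) e.
  by apply: hN => //; apply: leq_trans (Mj _); exact: leq_addl.
exists l.
  have [N /(_ N (leqnn N)) hN] := tail 1 ltr01.
  rewrite -(subrK (u N) l); apply: (in_spaceD sN); last exact: uN.
  by rewrite /in_space (seminormC sN) (le_lt_trans hN)// ltry.
apply/cvge0P => [n|e e0]; first exact: LN_ge0.
have [|N hN] := tail (e / 2); first by rewrite divr_gt0.
exists N => n /hN /le_lt_trans; apply.
by rewrite lte_fin ltr_pdivrMr// mulr_natr mulr2n ltrDl.
Qed.

End Orlicz_completeness.

(** * Comparison of distribution functions *)

Local Opaque LN_norm Linfty_norm.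

Section equimeasurable_comparison.
Context {R : realType}.
Local Notation mu := (@lebesgue_measure R).
Local Notation I01 := (`[0%R, 1%R]%classic : set R).
Implicit Types (x y : R -> R).

(** Domination of the distribution function of |x| by that of |y|. It is
    equivalent to domination of the nonincreasing rearrangements, and easier to
    combine with truncations. *)
Definition tail_le x y : Prop := forall s : R, 0 <= s ->
  (mu (I01 `&` [set t | (s < `|x t|)%R]) <= mu (I01 `&` [set t | (s < `|y t|)%R]))%E.

Lemma measurable_tail x s : measurable_fun I01 x ->
  measurable (I01 `&` [set t | (s < `|x t|)%R]).
Proof.
move=> mx; have mI := @measurable_I01 R.
have : measurable_fun I01 (fun t => s < `|x t|).
  by apply: measurable_fun_ltr => //; exact: measurableT_comp.
by move=> /(_ mI [set true]); apply.
Qed.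

Lemma tail_measure_fin x s : measurable_fun I01 x ->
  exists2 m : R, I01 m & mu (I01 `&` [set t | (s < `|x t|)%R]) = m%:E.
Proof.
move=> mx; have mA := measurable_tail s mx.
have A0 := measure_ge0 mu (I01 `&` [set t | (s < `|x t|)%R]).
have A1 : (mu (I01 `&` [set t | (s < `|x t|)%R]) <= 1)%E.
  rewrite -(@lebesgue_measure_I01 R); apply: le_measure; rewrite ?inE//.
have AE := ge0_lty_fin A0 (le_lt_trans A1 (ltry _)).
exists (fine (mu (I01 `&` [set t | (s < `|x t|)%R]))) => //.
by rewrite /= in_itv/= -!lee_fin -AE A0 A1.
Qed.

(** At m = mu(|y| > s) the rearrangement of y is at most s, hence so is that of
    x, which means mu(|x| > r) <= m for all r > s; the sets |x| > r increase to
    |x| > s. *)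
Lemma rearrangement_tail_le x y :
  measurable_fun I01 x -> measurable_fun I01 y ->
  (forall t, I01 t -> rearrangement x t <= rearrangement y t)%E -> tail_le x y.
Proof.
move=> mx my xy s s0; have [m Im mE] := tail_measure_fin s my.
have ym : (rearrangement y m <= s%:E)%E.
  by apply: ereal_inf_lbound; exists s => //; split => //; rewrite mE.
have {}ym := le_trans (xy m Im) ym; rewrite mE.
pose A n := I01 `&` [set t | s + n.+1%:R^-1 < `|x t|].
have mA n : measurable (A n) by exact: measurable_tail.
have Am n : (mu (A n) <= m%:E)%E.
  have : (rearrangement x m < (s + n.+1%:R^-1)%:E)%E.
    by apply: le_lt_trans ym _; rewrite lte_fin ltrDl invr_gt0.
  move=> /ereal_inf_lt[_ [r [r0 rm] <-]]; rewrite lte_fin => rs.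
  apply: le_trans rm; apply: le_measure; rewrite ?inE.
  - exact: mA.
  - exact: measurable_tail.
  by move=> t /= [It h]; split => //; exact: lt_trans h.
have AU : I01 `&` [set t | (s < `|x t|)%R] = \bigcup_n A n.
  apply/seteqP; split=> [t [It /= st]|t [n _ [It /= h]]].
    have [n hn] := @invS_small R (`|x t| - s) (ltac:(by rewrite subr_gt0)).
    by exists n => //; split => //=; rewrite addrC -ltrBrDr.
  by split => //=; apply: lt_trans h; rewrite ltrDl invr_gt0.
have := @nondecreasing_cvg_mu _ _ _ mu A mA.
rewrite -AU => /(_ (measurable_tail s mx)) cA.
have ndA : nondecreasing_seq A.
  move=> i j ij; apply/subsetPset => t [It /= h]; split => //=.
  by apply: le_lt_trans h; rewrite lerD2l lef_pV2 ?posrE// ler_nat ltnS.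
have {}cA := cA ndA; rewrite -(cvg_lim _ cA)//.
by apply: lime_le; [apply/cvg_ex; eexists; exact: cA|exact: nearW].
Qed.

(** Layer cake formula: the integral of a nonnegative function is the integral
    of its distribution function. *)
Lemma le_integral_tail (f g : R -> R) :
  measurable_fun I01 f -> measurable_fun I01 g ->
  (forall t, 0 <= f t) -> (forall t, 0 <= g t) -> tail_le f g ->
  (\int[mu]_(t in I01) (f t)%:E <= \int[mu]_(t in I01) (g t)%:E)%E.
Proof.
move=> mf mg f0 g0 fg; have mI := @measurable_I01 R.
pose P : probability _ R := uniform_prob (@ltr01 R).
have PE (h : R -> R) : measurable_fun I01 h -> (forall t, 0 <= h t) ->
    (\int[mu]_(t in I01) (h t)%:E = \int[P]_t ((h \_ I01) t)%:E)%E.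
  move=> mh h0; rewrite integral_uniform//.
  - rewrite subr0 invr1 mul1e; apply: eq_integral => t It.
    by rewrite patchE It.
  - by apply/measurable_EFinP; apply/(measurable_restrictT _ _).1.
  - by move=> t; rewrite lee_fin patchE; case: ifP.
rewrite !PE//.
have layer (h : R -> R) : measurable_fun I01 h -> (forall t, 0 <= h t) ->
  exists2 c : R -> \bar R, measurable_fun setT c &
    (\int[P]_t ((h \_ I01) t)%:E = \int[mu]_(r in `[0%R, +oo[) c r)%E /\
    forall r, 0 <= r -> c r = mu (I01 `&` [set t | (r < `|h t|)%R]).
  move=> mh h0.
  have mH : measurable_fun setT (h \_ I01) by apply/(measurable_restrictT _ _).1.
  pose mX := @isMeasurableFun.Build _ _ (measurableTypeR R) R (h \_ I01) mH.
  pose X : {RV P >-> R} := HB.pack (h \_ I01) mX.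
  exists (ccdf X); first exact: ccdf_measurable.
  split.
    have X0 t : (0 <= X t)%R by rewrite /= patchE; case: ifP.
    by rewrite -(ge0_expectation_ccdf X0) expectation_def.
  move=> r r0; rewrite /ccdf /distribution /pushforward.
  have mA := measurable_tail r mh.
  have -> : X @^-1` `]r, +oo[ = I01 `&` [set t | (r < `|h t|)%R].
    apply/seteqP; split=> t /=.
      rewrite in_itv/= andbT patchE; case: ifPn => [|_].
        by rewrite inE ger0_norm.
      by rewrite ltNge r0.
    by move=> [It rt]; rewrite in_itv/= andbT patchE mem_set// -(ger0_norm (h0 t)).
  rewrite -[in LHS](setIT (I01 `&` _)) -integral_indic// integral_uniform//.
  - rewrite subr0 invr1 mul1e integral_indic//; congr (mu _).
    by apply/setIidPl => t [].
  - exact/measurable_EFinP/measurable_indic.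
have [cf mcf [-> cfE]] := layer f mf f0.
have [cg mcg [-> cgE]] := layer g mg g0.
apply: ge0_le_integral => //.
- by move=> r /=; rewrite in_itv/= andbT => r0; rewrite cfE.
- exact: measurable_funTS.
- exact: measurable_funTS.
by move=> r /=; rewrite in_itv/= andbT => r0; rewrite cfE// cgE// fg.
Qed.


(** The level sets of the composition with the increasing Young function are
    level sets of |x|. *)
Lemma gauss_modular_tail_le x y u : measurable_fun I01 x ->
  measurable_fun I01 y -> 0 < u -> tail_le x y ->
  (gauss_modular x u <= gauss_modular y u)%E.
Proof.
move=> mx my u0 xy; apply: le_integral_tail.
- by apply/measurable_EFinP; exact: measurable_gauss_young u mx.
- by apply/measurable_EFinP; exact: measurable_gauss_young u my.
- by move=> t; exact: gauss_young_ge0.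
- by move=> t; exact: gauss_young_ge0.
move=> s s0; pose v := Num.sqrt (ln (1 + s)).
have s1 : 0 < 1 + s by rewrite ltr_wpDr.
have vE : s = gauss_young v.
  have l0 : 0 <= ln (1 + s) by rewrite ln_ge0// lerDl.
  by rewrite /gauss_young sqr_sqrtr// lnK ?posrE// addrAC subrr add0r.
have levels (z : R -> R) : I01 `&` [set t | (s < `|gauss_young (`|z t| / u)|)%R] =
    I01 `&` [set t | (u * v < `|z t|)%R].
  congr (_ `&` _); apply: eq_set => t.
  rewrite ger0_norm ?gauss_young_ge0// vE /gauss_young ltrD2r ltr_expR.
  rewrite ltr_sqr ?nnegrE ?sqrtr_ge0 ?divr_ge0 ?(ltW u0)//.
  by rewrite ltr_pdivlMr// mulrC.
by rewrite !levels xy// mulr_ge0 ?sqrtr_ge0 ?ltW.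
Qed.

Lemma LN_tail_le x y : measurable_fun I01 x -> measurable_fun I01 y ->
  tail_le x y -> (LN_norm x <= LN_norm y)%E.
Proof.
move=> mx my xy; apply: lee_of_ltR => u /LN_lt_modular[_ u0 h].
apply: (LN_le_modular mx u0); exact: le_trans (gauss_modular_tail_le mx my u0 xy) h.
Qed.

Definition clip (c r : R) : R := Num.max (- c) (Num.min c r).

Lemma clip_le c r : 0 <= c -> `|clip c r| <= c.
Proof.
move=> c0; rewrite ler_norml /clip le_max lexx/= ge_max ge_min lexx/= andbT.
by rewrite (le_trans _ c0)// oppr_le0.
Qed.

Lemma clip_excess c r s : 0 <= c -> 0 <= s ->
  (s < `|r - clip c r|) = (s + c < `|r|).
Proof.
move=> c0 s0; rewrite /clip.
case: (leP c r) => cr.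
  rewrite (max_idPr _); last by rewrite (le_trans _ c0)// oppr_le0.
  by rewrite !ger0_norm ?subr_ge0 ?(le_trans c0)// ltrBrDr.
case: (leP (- c) r) => rc.
  rewrite subrr normr0 ltNge s0/=; apply/esym/negbTE; rewrite -leNgt.
  apply: (@le_trans _ _ c); last by rewrite lerDr.
  by rewrite ler_norml rc ltW.
rewrite !ltr0_norm; [lra|lra|].
by rewrite opprK -ltrBrDr sub0r.
Qed.

Lemma measurable_clip c x : measurable_fun I01 x ->
  measurable_fun I01 (fun t => clip c (x t)).
Proof.
move=> mx; apply: measurable_maxr; first exact: measurable_cst.
by apply: measurable_minr => //; exact: measurable_cst.
Qed.

Lemma Linfty_clip c x : measurable_fun I01 x -> 0 <= c ->
  (Linfty_norm (fun t => clip c (x t)) <= c%:E)%E.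
Proof.
move=> mx c0; apply/Linfty_leP => //; first exact: measurable_clip.
by apply: aeW => t _; exact: clip_le.
Qed.

(** If |z| <= c almost everywhere, then |y - z| exceeds s wherever |y| exceeds
    s + c; the excess of x over the level c exceeds s exactly where |x| exceeds
    s + c. *)
Lemma clip_tail_le x y z : measurable_fun I01 x -> measurable_fun I01 y ->
  in_space Linfty_norm z -> tail_le x y ->
  tail_le (x - (fun t => clip (fine (Linfty_norm z)) (x t))) (y - z).
Proof.
move=> mx my zi xy s s0; set c := fine _.
have c0 : 0 <= c by rewrite fine_ge0// Linfty_ge0.
have mz := Linfty_measurable zi.
have myz : measurable_fun I01 (y - z) by exact: measurable_funB.
rewrite (_ : _ `&` _ = I01 `&` [set t | (s + c < `|x t|)%R]); last first.
  by congr (_ `&` _); apply: eq_set => t; rewrite -clip_excess.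
apply: le_trans (xy _ (addr_ge0 s0 c0)) _.
have [N [mN N0 hN]] := Linfty_ae_bound zi.
apply: (@le_trans _ _ (mu ((I01 `&` [set t | (s < `|(y - z) t|)%R]) `|` N))).
  apply: le_measure; rewrite ?inE.
  - exact: measurable_tail.
  - by apply: measurableU => //; exact: measurable_tail.
  move=> t [It /= syt]; have [zt|/hN] := pselect (I01 t -> `|z t| <= c); last by right.
  left; split => //=; have {}zt := zt It.
  have := ler_normB (y t - z t) (- z t); rewrite opprK subrK normrN => h.
  by rewrite -[(y - z) t]/(y t - z t); lra.
apply: le_trans (measureU2 _ _ _) _ => //; first exact: measurable_tail.
by rewrite [X in (_ + X)%E](_ : _ = 0%E)// adde0.
Qed.

End equimeasurable_comparison.

(** * The space G and rearrangement invariance *)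

Section space_G.
Context {R : realType}.
Local Notation mu := (@lebesgue_measure R).
Local Notation I01 := (`[0%R, 1%R]%classic : set R).
Implicit Types (x y : R -> R).

Definition in_G x : Prop := in_space LN_norm x /\
  forall e : R, 0 < e -> exists2 y : R -> R,
    in_space Linfty_norm y & (LN_norm (x - y)%R < e%:E)%E.

Lemma G_normE x : in_G x -> G_norm x = LN_norm x.
Proof. by move=> xG; rewrite /G_norm asboolT. Qed.

Lemma in_space_G x : in_space G_norm x <-> in_G x.
Proof.
rewrite /in_space; split=> [|[x1 x2]]; last by rewrite G_normE.
by rewrite /G_norm; case: asboolP => // _; rewrite ltxx.
Qed.

Lemma LN_le_G x : (LN_norm x <= G_norm x)%E.
Proof. by rewrite /G_norm; case: asboolP => // _; rewrite leey. Qed.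

Local Opaque G_norm.

Lemma G_ge0 x : (0 <= G_norm x)%E.
Proof. exact: le_trans (LN_ge0 x) (LN_le_G x). Qed.

Lemma LN_le_Linfty x : (LN_norm x <= 2%:E * Linfty_norm x)%E.
Proof.
have [xi|] := ltP (Linfty_norm x) +oo%E; last first.
  by rewrite leye_eq => /eqP ->; rewrite gt0_muley ?leey// lte_fin.
have mx := Linfty_measurable xi; have xb := Linfty_ae_bound xi.
rewrite (ge0_lty_fin (Linfty_ge0 x) xi) -EFinM; set M := fine _.
have M0 : 0 <= M by rewrite fine_ge0// Linfty_ge0.
apply: LN_le_of_gt => // [|v Mv]; first by rewrite mulr_ge0.
have v0 : 0 < v by apply: le_lt_trans Mv; rewrite mulr_ge0.
have mI := @measurable_I01 R.
apply: (@le_trans _ _ (\int[mu]_(t in I01) (cst 1%E) t)%E); last first.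
  by rewrite integral_cst//= lebesgue_measure_I01 mule1.
apply: ae_ge0_le_integral => //.
- by move=> t _; rewrite lee_fin gauss_young_ge0.
- exact: measurable_gauss_young.
apply: aeS xb => t /[apply] xt; rewrite lee_fin.
have h : `|x t| / v <= 2^-1.
  by rewrite ler_pdivrMr// mulrC ler_pdivlMr//; move: xt Mv; rewrite -/M; lra.
apply: le_trans (gauss_young_le _ h) _; first by rewrite divr_ge0// ltW.
rewrite /gauss_young lerBlDr.
have : expR (2^-1 ^+ 2 : R) <= expR (2^-1).
  by rewrite ler_expR expr2; lra.
move=> /le_trans; apply.
have := expR_ge1Dx (- 2^-1 : R); rewrite expRN => h1.
have e0 := expR_gt0 (2^-1 : R).
have : expR (2^-1) * (1 - 2^-1) <= 1 :> R by rewrite -ler_pdivlMl// mulr1.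
by lra.
Qed.

Lemma in_G_Linfty x : in_space Linfty_norm x -> in_G x.
Proof.
move=> xi; split=> [|e e0].
  apply: le_lt_trans (LN_le_Linfty x) _.
  by rewrite lte_mul_pinfty// lee_fin.
by exists x => //; rewrite subrr (seminorm0 (@LN_seminorm R)) lte_fin.
Qed.

Lemma G_le_Linfty x : ((2^-1)%:E * G_norm x <= Linfty_norm x)%E.
Proof.
have [xi|] := ltP (Linfty_norm x) +oo%E; last first.
  by rewrite leye_eq => /eqP ->; rewrite leey.
by rewrite lee_pdivrMl// G_normE ?LN_le_Linfty//; exact: in_G_Linfty.
Qed.

Lemma in_GD x y : in_G x -> in_G y -> in_G (x + y).
Proof.
have sN := @LN_seminorm R; have sI := @Linfty_seminorm R.
move=> [x1 xa] [y1 ya]; split; first exact (in_spaceD sN x1 y1).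
move=> e e0; have e20 : 0 < e / 2 by rewrite divr_gt0.
have [z zi hz] := xa _ e20; have [w wi hw] := ya _ e20.
exists (z + w); first exact (in_spaceD sI zi wi).
rewrite opprD addrACA; apply: le_lt_trans (seminormD sN _ _) _.
have -> : e%:E = ((e / 2)%:E + (e / 2)%:E)%E by rewrite -EFinD -splitr.
exact: lteD hz hw.
Qed.

Lemma in_GZ c x : in_G x -> in_G (c *: x).
Proof.
have sN := @LN_seminorm R; have sI := @Linfty_seminorm R.
move=> [x1 xa]; split.
  by rewrite /in_space (seminormZ sN) lte_mul_pinfty// lee_fin.
move=> e e0.
have [|z zi hz] := xa (e / (`|c| + 1)).
  by rewrite divr_gt0// ltr_wpDl.
exists (c *: z); first by rewrite /in_space (seminormZ sI) lte_mul_pinfty// lee_fin.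
rewrite -scalerBr (seminormZ sN).
have c1 : 0 < `|c| + 1 by rewrite ltr_wpDl.
apply: (@le_lt_trans _ _ ((`|c| + 1)%:E * LN_norm (x - z)%R)%E).
  by apply: lee_wpmul2r; [exact: LN_ge0|rewrite lee_fin lerDl].
by rewrite muleC -lte_pdivlMr// -EFinM.
Qed.

Lemma G_seminorm : ext_seminorm (@G_norm R).
Proof.
have sN := @LN_seminorm R; apply: ext_seminorm_criterion.
- exact: G_ge0.
- have G0 := in_G_Linfty (in_space0 (@Linfty_seminorm R)).
  by rewrite (G_normE G0) (seminorm0 sN).
- move=> c x c0; have [/in_space_G xi|] := ltP (G_norm x) +oo%E; last first.
    by rewrite leye_eq => /eqP ->; rewrite gt0_muley ?leey// lte_fin normr_gt0.
  by rewrite (G_normE (in_GZ c xi)) (G_normE xi) (seminormZ sN).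
- move=> x y a b xa yb.
  have xG : in_G x by apply/in_space_G; rewrite /in_space (le_lt_trans xa)// ltry.
  have yG : in_G y by apply/in_space_G; rewrite /in_space (le_lt_trans yb)// ltry.
  rewrite (G_normE (in_GD xG yG)) EFinD.
  apply: le_trans (seminormD sN _ _) _.
  by rewrite (G_normE xG) in xa; rewrite (G_normE yG) in yb; exact: leeD.
Qed.

(** G is closed in the Orlicz space. *)
Lemma in_G_of_approx x : in_space LN_norm x ->
  (forall e : R, 0 < e -> exists2 y, in_G y & (LN_norm (x - y)%R < e%:E)%E) ->
  in_G x.
Proof.
move=> x1 xa; split => // e e0.
have e20 : 0 < e / 2 by rewrite divr_gt0.
have [y [_ ya] hy] := xa _ e20; have [z zi hz] := ya _ e20.
exists z => //; apply: le_lt_trans (seminorm_triangle (@LN_seminorm R) y _ _) _.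
have -> : e%:E = ((e / 2)%:E + (e / 2)%:E)%E by rewrite -EFinD -splitr.
exact: lteD hy hz.
Qed.

Lemma G_banach : is_banach (@null_on_I01 R) (@G_norm R).
Proof.
have [h1 h2 h3] := G_seminorm; have sN := @LN_seminorm R.
split=> //.
- move=> x; split=> [x0|/LN_eq0 x0].
    by apply/LN_eq0/le_anti; rewrite LN_ge0 andbT -x0 LN_le_G.
  rewrite G_normE//; split; first by rewrite /in_space x0 ltry.
  move=> e e0; exists 0; first exact: (in_space0 (@Linfty_seminorm R)).
  by rewrite subr0 x0 lte_fin.
- move=> u uG uC; have uiG n : in_G (u n) by apply/in_space_G; exact: uG.
  have [||l l1 lc] := LN_complete (u := u).
  + by move=> n; have [] := uiG n.
  + move=> e e0; have [N hN] := uC e e0; exists N => m n Nm Nn.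
    exact: le_lt_trans (LN_le_G _) (hN _ _ Nm Nn).
  have {}lc : forall e : R, 0 < e ->
      exists N, forall n, (N <= n)%N -> (LN_norm (u n - l)%R < e%:E)%E.
    by apply/cvge0P => // n; exact: LN_ge0.
  have lG : in_G l.
    apply: in_G_of_approx => // e e0; have [N hN] := lc e e0.
    by exists (u N) => //; rewrite (seminormC sN) hN.
  exists l; first exact/in_space_G.
  apply/cvge0P => [n|e e0]; first exact: G_ge0.
  have [N hN] := lc e e0; exists N => n Nn.
  have ulG : in_G (u n - l).
    by rewrite -scaleN1r; exact: in_GD (uiG n) (in_GZ _ lG).
  by rewrite (G_normE ulG); exact: hN.
Qed.

(** If z is a bounded function close to y, then truncating x at the level given
    by the norm of z is at least as good an approximation. *)
Lemma in_G_tail_le x y : measurable_fun I01 x -> tail_le x y -> in_G y ->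
  in_G x.
Proof.
move=> mx xy [y1 ya]; have my := LN_measurable y1.
split; first exact: le_lt_trans (LN_tail_le mx my xy) y1.
move=> e e0; have [z zi hz] := ya e e0; have mz := Linfty_measurable zi.
exists (fun t => clip (fine (Linfty_norm z)) (x t)).
  apply: le_lt_trans (Linfty_clip mx _) _; last by rewrite ltry.
  by rewrite fine_ge0// Linfty_ge0.
apply: le_lt_trans hz; apply: LN_tail_le.
- by apply: measurable_funB => //; exact: measurable_clip.
- exact: measurable_funB.
exact: clip_tail_le.
Qed.

(** In a decomposition y = y0 + y1, only the L_oo norm c of y0 matters. Cutting x
    at the level c gives a bounded part of norm at most c and a remainder whose
    distribution function is dominated by that of y1. *)
Lemma K_functional_tail_le t x y : 0 <= t -> measurable_fun I01 x ->
  tail_le x y ->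
  (K_functional Linfty_norm G_norm t x <= K_functional Linfty_norm G_norm t y)%E.
Proof.
move=> t0 mx xy; rewrite -[leRHS]mul1e.
apply: (le_K_functional (@Linfty_seminorm R) G_seminorm
  (@Linfty_seminorm R) G_seminorm) => // y0 y1 yE y0i /in_space_G y1G.
have my0 := Linfty_measurable y0i; have my1 := LN_measurable y1G.1.
have my : measurable_fun I01 y by rewrite yE; exact: measurable_funD.
set c := fine (Linfty_norm y0).
have c0 : 0 <= c by rewrite fine_ge0// Linfty_ge0.
pose x0 := fun t => clip c (x t).
have mx1 : measurable_fun I01 (x - x0).
  by apply: measurable_funB => //; exact: measurable_clip.
have x1y1 : tail_le (x - x0) y1.
  by rewrite (_ : y1 = y - y0); [exact: clip_tail_le|rewrite yE addrAC subrr add0r].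
exists x0, (x - x0); split; first by rewrite addrC subrK.
- rewrite mul1e (ge0_lty_fin (Linfty_ge0 y0) y0i); exact: Linfty_clip.
- have x1G := in_G_tail_le mx1 x1y1 y1G.
  by rewrite mul1e (G_normE x1G) (G_normE y1G); exact: LN_tail_le.
Qed.

Lemma K_method_Linfty_G_rearrangement_invariant (E : (int -> R) -> \bar R) :
  is_banach_sequence_lattice E ->
  in_space E (fun k : int => Num.min 1 (2%:R ^ k)) ->
  rearrangement_invariant (K_method Linfty_norm G_norm E).
Proof.
move=> E_lattice E_min.
have sI := @Linfty_seminorm R; have sG := G_seminorm.
have h0 : 0 < 2^-1 :> R := half_gt0 R.
have in_sumP x := in_sum_ordered sI G_banach h0 G_le_Linfty x.
split.
- exact: (K_method_banach E_lattice E_min sI G_banach h0 G_le_Linfty).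
- by move=> x /K_method_in_sum/in_sumP/in_space_G[/LN_measurable].
move=> x y mx yX xy.
have yG : in_G y by apply/in_space_G/in_sumP/K_method_in_sum/yX.
have my := LN_measurable yG.1.
have xy_tail := rearrangement_tail_le mx my xy.
suff h : (K_method Linfty_norm G_norm E x <= K_method Linfty_norm G_norm E y)%E.
  by split => //; exact: le_lt_trans yX.
rewrite -[leRHS]mul1e; apply: le_K_method => //.
  by move=> _; apply/in_sumP/in_space_G; exact: in_G_tail_le yG.
by move=> k; rewrite mul1e K_functional_tail_le// exp2z_ge0.
Qed.

End space_G.

(** * Halving the unit interval *)

Section halving.
Context {R : realType}.
Local Notation mu := (@lebesgue_measure R).
Local Notation I01 := (`[0%R, 1%R]%classic : set R).

(** Both sides are integrals of f against measures that agree on half-open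
    intervals, hence on all Borel sets. *)
Lemma ge0_integral_affine (a b : R) (D : set R) (f : R -> \bar R) : 0 < a ->
  measurable D -> measurable_fun D f -> (forall y, D y -> 0 <= f y)%E ->
  (\int[mu]_(y in D) f y =
   a%:E * \int[mu]_(x in (fun x => (a * x + b)%R) @^-1` D) f (a * x + b)%R)%E.
Proof.
move=> a0 mD mf f0.
pose h : measurableTypeR R -> measurableTypeR R := fun x => a * x + b.
have mh : measurable_fun setT h.
  apply: measurable_funD => //; exact: mulrl_measurable.
pose k : {nonneg R} := NngNum (ltW a0).
pose nu_ : {measure set (measurableTypeR R) -> \bar R} :=
  mscale k (pushforward mu h).
pose nu := nu_ mh.
transitivity (\int[nu]_(y in D) f y)%E.
  apply: eq_measure_integral => A mA _.
  apply: lebesgue_measure_unique mA => _ [[c d] _ <-] /=.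
  rewrite /nu /nu_ /mscale /= /pushforward.
  have -> : h @^-1` `]c, d] = `](c - b) / a, (d - b) / a]%classic.
    apply/seteqP; split=> x /=; rewrite !in_itv/= /h.
      by rewrite ltr_pdivrMr// ler_pdivlMr// ltrBlDr lerBrDr (mulrC x).
    by rewrite ltr_pdivrMr// ler_pdivlMr// ltrBlDr lerBrDr (mulrC x).
  rewrite !lebesgue_measure_itv/= !lte_fin ltr_pM2r ?invr_gt0// ltrD2r.
  case: ifP => // cd; last by rewrite mule0.
  rewrite -!EFinD -EFinM; congr EFin; field.
  by rewrite gt_eqF.
rewrite /nu /nu_ ge0_integral_mscale// ge0_integral_pushforward//.
by move=> y; rewrite inE; exact: f0.
Qed.

Lemma integral_halves (f : R -> \bar R) :
  measurable_fun I01 f -> (forall t, I01 t -> 0 <= f t)%E ->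
  (\int[mu]_(t in I01) f t =
   (2^-1)%:E * \int[mu]_(t in I01) f (2^-1 * t)%R +
   (2^-1)%:E * \int[mu]_(t in I01) f (2^-1 * t + 2^-1)%R)%E.
Proof.
move=> mf f0; have h0 := half_gt0 R.
pose L : set R := `[0, 2^-1]%classic; pose U : set R := `]2^-1, 1]%classic.
have LU : I01 = L `|` U.
  by rewrite /L /U -itv_bndbnd_setU// bnd_simp ?invr_ge0// invf_le1// ler1n.
have mL : measurable L by exact: measurable_itv.
have mU : measurable U by exact: measurable_itv.
have LI : L `<=` I01 by rewrite LU => t; left.
have UI : U `<=` I01 by rewrite LU => t; right.
have mfL : measurable_fun L f by apply: measurable_funS mf => //; exact: measurable_I01.
have mfU : measurable_fun U f by apply: measurable_funS mf => //; exact: measurable_I01.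
rewrite {1}LU ge0_integral_setU//; last 3 first.
- by rewrite -LU.
- by rewrite -LU.
- apply/disj_setPS => t []; rewrite /L /U /= !in_itv/= => /andP[_ a] /andP[b _].
  by move: (lt_le_trans b a); rewrite ltxx.
rewrite (@ge0_integral_affine 2^-1 0 L)//; last by move=> t /LI; exact: f0.
rewrite (@ge0_integral_affine 2^-1 2^-1 U)//; last by move=> t /UI; exact: f0.
have -> : (fun x : R => 2^-1 * x + 0) @^-1` L = I01.
  by apply/seteqP; split=> t; rewrite /L /= !in_itv/= addr0; lra.
have -> : (fun x : R => 2^-1 * x + 2^-1) @^-1` U = `]0, 1]%classic.
  by apply/seteqP; split=> t; rewrite /U /= !in_itv/=; lra.
congr (_ * _ + _ * _)%E; first by under eq_integral do rewrite addr0.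
rewrite integral_itv_obnd_cbnd//.
apply: (measurable_comp mU) => //.
  by move=> _ [t /= + <-]; rewrite /U /= !in_itv/=; lra.
apply: measurable_funD => //; exact: mulrl_measurable.
Qed.

Lemma measurable_left_half d (T : measurableType d) (f : R -> T) :
  measurable_fun I01 f -> measurable_fun I01 (fun t => f (2^-1 * t)%R).
Proof.
move=> mf; apply: (measurable_comp _ _ mf).
- exact: measurable_I01.
- by move=> _ [t /= + <-]; rewrite !in_itv/=; lra.
exact: mulrl_measurable.
Qed.

Lemma measurable_right_half d (T : measurableType d) (f : R -> T) :
  measurable_fun I01 f -> measurable_fun I01 (fun t => f (2^-1 * t + 2^-1)%R).
Proof.
move=> mf; apply: (measurable_comp _ _ mf).
- exact: measurable_I01.
- by move=> _ [t /= + <-]; rewrite !in_itv/=; lra.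
by apply: measurable_funD => //; exact: mulrl_measurable.
Qed.

End halving.

(** * Rademacher functions as independent signs *)

Section rademacher_theory.
Context {R : realType}.
Local Notation mu := (@lebesgue_measure R).
Local Notation I01 := (`[0%R, 1%R]%classic : set R).

(** Shifted by one, because the Rademacher function of index 0 is constant on
    ]0, 1[. *)
Definition sign_seq (t : R) (k : nat) : R := rademacher k.+1 t.

Definition scons (e : R) (s : nat -> R) (k : nat) : R :=
  if k is k'.+1 then s k' else e.

Lemma rademacher0 t : 0 < t < 1 -> rademacher 0 t = 1 :> R.
Proof.
move=> /andP[t0 t1]; rewrite /rademacher expr0 mul1r gtr0_sg// sin_gt0_pi//.
by rewrite mulr_gt0 ?pi_gt0//= gtr_pMr ?pi_gt0.
Qed.

Lemma sign_seq_left t : 0 < t < 1 -> sign_seq (2^-1 * t) = scons 1 (sign_seq t).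
Proof.
move=> t01; apply/funext => -[|k]; rewrite /sign_seq /scons.
  rewrite -[RHS](rademacher0 t01) /rademacher; congr (Num.sg (sin _)).
  by rewrite expr1 expr0; field.
by rewrite /rademacher; congr (Num.sg (sin _)); rewrite exprS; field.
Qed.

Lemma sign_seq_right t : 0 < t < 1 ->
  sign_seq (2^-1 * t + 2^-1) = scons (- 1) (sign_seq t).
Proof.
move=> t01; apply/funext => -[|k]; rewrite /sign_seq /scons.
  transitivity (- rademacher 0 t : R); last by rewrite rademacher0.
  rewrite /rademacher -sgrN -sinDpi; congr (Num.sg (sin _)).
  by rewrite expr1 expr0; field.
rewrite /rademacher; congr Num.sg.
have -> : 2 ^+ k.+2 * pi * (2^-1 * t + 2^-1) =
    2 ^+ k.+1 * pi * t + (pi *+ 2) *+ (2 ^ k) :> R.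
  rewrite -mulrnA -[pi *+ _]mulr_natr natrM natrX !exprS.
  by field.
by rewrite (periodicn (@sinD2pi R)).
Qed.

Lemma measurable_rademacher k D : measurable_fun D (@rademacher R k).
Proof.
apply: measurable_funTS.
apply: (@measurableT_comp _ _ _ _ _ _ (@Num.sg R) _ (fun t => sin (2 ^+ k * pi * t))).
  apply: nondecreasing_measurable => // x y xy.
  by case: (sgrP x) xy; case: (sgrP y) => // *; lra.
apply: measurableT_comp.
  by apply: continuous_measurable_fun; exact: continuous_sin.
exact: mulrl_measurable.
Qed.

(** Independence and symmetry of the signs in recursive form: the first sign is
    1 on the left half of the interval and -1 on the right half, and on each half
    the remaining signs reproduce the whole sequence. *)
Lemma integral_sign_seq (H : (nat -> R) -> \bar R) :
  measurable_fun I01 (fun t => H (sign_seq t)) -> (forall s, 0 <= H s)%E ->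
  (\int[mu]_(t in I01) H (sign_seq t) =
   (2^-1)%:E * \int[mu]_(t in I01) H (scons 1 (sign_seq t)) +
   (2^-1)%:E * \int[mu]_(t in I01) H (scons (- 1) (sign_seq t)))%E.
Proof.
move=> mH H0; rewrite integral_halves//.
pose O : set R := `]0, 1[%classic.
have oo_sub : O `<=` I01 by apply: subset_itvW.
have moo : measurable O by exact: measurable_itv.
have half (f : R -> R) (e : R) : measurable_fun I01 (fun t => H (sign_seq (f t))) ->
    (forall t, 0 < t < 1 -> sign_seq (f t) = scons e (sign_seq t)) ->
    (\int[mu]_(t in I01) H (sign_seq (f t)) =
     \int[mu]_(t in I01) H (scons e (sign_seq t)))%E.
  move=> mf fE.
  have mfo : measurable_fun O (fun t => H (sign_seq (f t))).
    by apply: measurable_funS mf => //; exact: measurable_I01.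
  have HE : {in O, (fun t => H (sign_seq (f t))) =1
      (fun t => H (scons e (sign_seq t)))}.
    by move=> t; rewrite inE /O /= in_itv/= => /fE ->.
  have mso := eq_measurable_fun _ HE mfo.
  rewrite (integral_itv_bndoo true false mfo).
  rewrite (integral_itv_bndoo true false mso).
  by apply: eq_integral => t; exact: HE.
congr (_ * _ + _ * _)%E; apply: half.
- exact: (measurable_left_half mH).
- exact: sign_seq_left.
- exact: (measurable_right_half mH).
- exact: sign_seq_right.
Qed.

Lemma measurable_sign_seq k D : measurable_fun D (fun t => sign_seq t k).
Proof. exact: measurable_rademacher. Qed.

Lemma ae_I01 (P : R -> Prop) : (forall t, 0 < t < 1 -> P t) ->
  {ae mu, forall t, I01 t -> P t}.
Proof.
move=> h; exists [set 0; 1]; split.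
- exact: measurableU.
- by rewrite countable_lebesgue_measure0//; exact/finite_set_countable/finite_set2.
move=> t /= /not_implyP[]; rewrite in_itv/= => /andP[t0 t1] nP.
have [->|t0'] := eqVneq t 0; first by left.
have [->|t1'] := eqVneq t 1; first by right.
by exfalso; apply: nP; apply: h; rewrite !lt_neqAle t0 t1 t1' eq_sym t0'.
Qed.

Definition sign_sum (n : nat) (a e : nat -> R) : R := \sum_(k < n) a k * e k.

Definition behead_seq (a : nat -> R) : nat -> R := fun k => a k.+1.

Lemma sign_sum_scons n a x e :
  sign_sum n.+1 a (scons x e) = a 0%N * x + sign_sum n (behead_seq a) e.
Proof. by rewrite /sign_sum big_ord_recl. Qed.

Lemma measurable_sign_sum n a D :
  measurable_fun D (fun t => sign_sum n a (sign_seq t)).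
Proof.
apply: measurable_sum => k; apply: measurable_funM; first exact: measurable_cst.
exact: measurable_sign_seq.
Qed.

Definition sqr_sum (n : nat) (a : nat -> R) : R := \sum_(k < n) a k ^+ 2.

Lemma sqr_sum_recl n a :
  sqr_sum n.+1 a = a 0%N ^+ 2 + sqr_sum n (behead_seq a).
Proof. by rewrite /sqr_sum big_ord_recl. Qed.

Lemma sqr_sum_ge0 n a : 0 <= sqr_sum n a.
Proof. by apply: sumr_ge0 => k _; exact: sqr_ge0. Qed.

End rademacher_theory.

(** * Estimates for finite sign sums *)

Section subgaussian.
Context {R : realType}.
Local Notation mu := (@lebesgue_measure R).
Local Notation I01 := (`[0%R, 1%R]%classic : set R).

(** For |x| <= 1/2 this follows from exp(x) <= 1/(1 - x). With q = exp(x^2 / 2),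
    the estimate at x / 2 gives the one at x through
    cosh(x) = 2 cosh(x/2)^2 - 1, because 2 q^2 - 1 <= q^4. *)
Lemma cosh_le_gauss (x : R) : (expR x + expR (- x)) / 2 <= expR (2 * x ^+ 2).
Proof.
have small y : `|y| <= 2^-1 :> R ->
    (expR y + expR (- y)) / 2 <= expR (2 * y ^+ 2).
  rewrite ler_norml => /andP[y1 y2].
  have e0 := expR_gt0 y; have e1 := expR_gt0 (- y).
  have h1 : expR y * (1 - y) <= 1.
    have := expR_ge1Dx (- y); rewrite expRN => h.
    by rewrite -ler_pdivlMl// mulr1.
  have h2 : expR (- y) * (1 + y) <= 1.
    have := expR_ge1Dx y; rewrite -[in leRHS](opprK y) expRN => h.
    by rewrite -ler_pdivlMl// mulr1.
  apply: le_trans (expR_ge1Dx _).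
  have y3 : y ^+ 2 <= 2^-1 ^+ 2.
    by rewrite -[y ^+ 2]real_normK ?num_real// ler_sqr ?nnegrE// ler_norml y1 y2.
  have : (expR y + expR (- y)) / 2 * (1 - y ^+ 2) <= 1.
    have := ler_wpM2r (_ : 0 <= 1 + y) h1; have := ler_wpM2r (_ : 0 <= 1 - y) h2.
    by move=> /(_ ltac:(lra)) k2 /(_ ltac:(lra)) k1; lra.
  by move=> h; nra.
have double y : (expR (y / 2) + expR (- (y / 2))) / 2 <= expR (2 * (y / 2) ^+ 2) ->
    (expR y + expR (- y)) / 2 <= expR (2 * y ^+ 2).
  set c := (X in X <= _) => hc; set q := expR (2 * (y / 2) ^+ 2) in hc.
  have c0 : 0 <= c by rewrite divr_ge0// addr_ge0// expR_ge0.
  have -> : expR (2 * y ^+ 2) = q ^+ 4.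
    by rewrite /q -expRM_natl; congr expR; field.
  have -> : (expR y + expR (- y)) / 2 = 2 * c ^+ 2 - 1.
    have -> : expR y = expR (y / 2) ^+ 2 by rewrite -expRM_natl; congr expR; field.
    have -> : expR (- y) = expR (- (y / 2)) ^+ 2.
      by rewrite -expRM_natl; congr expR; field.
    rewrite /c; have : expR (y / 2) * expR (- (y / 2)) = 1 by rewrite -expRD subrr expR0.
    by move: (expR _) (expR _) => u v uv; field: uv.
  have : c ^+ 2 <= q ^+ 2 by rewrite ler_sqr ?nnegrE// (le_trans c0).
  by have := sqr_ge0 (q ^+ 2 - 1); lra.
have [n hn] : exists n, `|x| <= 2 ^+ n / 2.
  exists (Num.bound (2 * `|x|)).
  have h : 2 * `|x| < (Num.bound (2 * `|x|))%:R by rewrite archi_boundP// mulr_ge0.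
  rewrite ler_pdivlMr// mulrC; apply: le_trans (ltW h) _.
  by rewrite -natrX ler_nat ltnW// ltn_expl.
elim: n x hn => [|n ih] x hn; first by apply: small; move: hn; rewrite expr0 div1r.
apply: double; apply: ih; rewrite normrM normfV (ger0_norm (ler0n _ 2)).
by move: hn; rewrite exprS; lra.
Qed.

Lemma two_point_gauss (g s a : R) : 0 <= g ->
  2^-1 * expR (g * (s + a) ^+ 2) + 2^-1 * expR (g * (s - a) ^+ 2) <=
  expR (g * a ^+ 2 + g * (1 + 8 * g * a ^+ 2) * s ^+ 2).
Proof.
move=> g0; set x := 2 * g * s * a.
have -> : g * (s + a) ^+ 2 = g * (s ^+ 2 + a ^+ 2) + x by rewrite /x; ring.
have -> : g * (s - a) ^+ 2 = g * (s ^+ 2 + a ^+ 2) + (- x) by rewrite /x; ring.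
have -> : g * a ^+ 2 + g * (1 + 8 * g * a ^+ 2) * s ^+ 2 =
  g * (s ^+ 2 + a ^+ 2) + 2 * x ^+ 2 by rewrite /x; ring.
rewrite !expRD mulrCA [X in _ + X]mulrCA -mulrDr ler_wpM2l ?expR_ge0//.
by rewrite -mulrDr mulrC cosh_le_gauss.
Qed.

(** Khintchine's inequality in exponential-square form. Integrating out one sign
    turns the coefficient g of the square into at most g / (1 - 8 g a^2), and the
    product of the factors 1 - 8 g a^2 telescopes to 1 - 8 b (sum of squares).
    The start s makes the induction possible. *)
Lemma integral_gauss_sign_sum n (a : nat -> R) (b s : R) :
  0 <= b -> 16 * b * sqr_sum n a <= 1 ->
  (\int[mu]_(t in I01) (expR (b * (s + sign_sum n a (sign_seq t)) ^+ 2))%:E <=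
   (expR (2 * b * sqr_sum n a + b / (1 - 8 * b * sqr_sum n a) * s ^+ 2))%:E)%E.
Proof.
move=> b0; elim: n a s => [|n ih] a s hb.
  rewrite /sqr_sum big_ord0 !mulr0 subr0 divr1 add0r.
  under eq_integral do rewrite /sign_sum big_ord0 addr0.
  by rewrite integral_cst ?measurable_I01//= lebesgue_measure_I01 mule1.
rewrite sqr_sum_recl in hb *.
set q := sqr_sum n (behead_seq a) in hb *.
have q0 : 0 <= q := sqr_sum_ge0 _ _; have a0 := sqr_ge0 (a 0%N).
have bq0 : 0 <= b * q by rewrite mulr_ge0.
have ba0 : 0 <= b * a 0%N ^+ 2 by rewrite mulr_ge0.
pose H (e : nat -> R) := (expR (b * (s + sign_sum n.+1 a e) ^+ 2))%:E.
have mH : measurable_fun I01 (fun t => H (sign_seq t)).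
  apply/measurable_EFinP; apply: measurableT_comp => //.
  apply: measurable_funM => //; apply: measurable_funX.
  by apply: measurable_funD => //; exact: measurable_sign_sum.
rewrite (integral_sign_seq mH); last by move=> e; rewrite lee_fin expR_ge0.
have hq : 16 * b * q <= 1 by move: hb; rewrite mulrDr; lra.
have HE x (t : R) : H (scons x (sign_seq t)) =
    (expR (b * ((s + a 0%N * x) + sign_sum n (behead_seq a) (sign_seq t)) ^+ 2))%:E.
  by rewrite /H sign_sum_scons addrA.
under eq_integral do rewrite HE mulr1.
under [X in (_ + _ * X)%E]eq_integral do rewrite HE mulrN1.
(* g is the coefficient of the square after the signs behind the first one have
   been integrated out. *)
pose g := b / (1 - 8 * b * q).
have D0 : 0 < 1 - 8 * b * q by lra.
have g0 : 0 <= g by rewrite divr_ge0// ltW.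
have h0 : (0 <= (2^-1)%:E :> \bar R)%E by rewrite lee_fin.
apply: le_trans (leeD (lee_wpmul2l h0 (ih _ _ hq)) (lee_wpmul2l h0 (ih _ _ hq))) _.
rewrite -/q -/g -!EFinM -EFinD lee_fin.
rewrite !expRD !(mulrCA 2^-1) -mulrDr.
apply: le_trans (ler_wpM2l (expR_ge0 _) (two_point_gauss _ _ g0)) _.
rewrite -!expRD ler_expR.
have gb : g <= 2 * b by rewrite /g ler_pdivrMr//; nra.
have D1 : 0 < 1 - 8 * b * (a 0%N ^+ 2 + q) by lra.
rewrite addrA; apply: lerD.
  have : g * a 0%N ^+ 2 <= 2 * b * a 0%N ^+ 2 by rewrite ler_wpM2r.
  by rewrite [2 * b * (_ + _)]mulrDr; lra.
apply: ler_wpM2r; first exact: sqr_ge0.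
rewrite ler_pdivlMr//.
have -> : 1 - 8 * b * (a 0%N ^+ 2 + q) =
    (1 - 8 * g * a 0%N ^+ 2) * (1 - 8 * b * q).
  by rewrite /g; field; rewrite gt_eqF.
have bE : b = g * (1 - 8 * b * q) by rewrite /g divfK// gt_eqF.
rewrite [leRHS]bE mulrA; apply: ler_wpM2r; first exact: ltW.
have -> : g * (1 + 8 * g * a 0%N ^+ 2) * (1 - 8 * g * a 0%N ^+ 2) =
  g - g * (8 * g * a 0%N ^+ 2) ^+ 2 by ring.
by rewrite gerBl mulr_ge0// sqr_ge0.
Qed.

Definition sign_max_event (n : nat) (a : nat -> R) (s l : R) (e : nat -> R) :=
  exists2 m, (m <= n)%N & l < `|s + sign_sum m a e|.

Lemma measurable_sign_max_event n a s l :
  measurable (I01 `&` [set t | sign_max_event n a s l (sign_seq t)]).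
Proof.
have -> : I01 `&` [set t | sign_max_event n a s l (sign_seq t)] =
    \bigcup_(m in [set m | (m <= n)%N])
      (I01 `&` [set t | l < `|s + sign_sum m a (sign_seq t)|]).
  apply/seteqP; split=> [t [It [m mn h]]|t [m mn [It h]]]; first by exists m.
  by split => //; exists m.
apply: bigcup_measurable => m _.
apply: measurable_tail; apply: measurable_funD => //.
exact: measurable_sign_sum.
Qed.

(** Kolmogorov's maximal inequality. If |s| > l the bound is trivial; otherwise
    the event for s is the event for s + a_0 or s - a_0 according to the first
    sign, and the mean of (s + a_0)^2 and (s - a_0)^2 is s^2 + a_0^2. *)
Lemma sign_maximal_inequality n a s l : 0 < l ->
  ((l ^+ 2)%:E * mu (I01 `&` [set t | sign_max_event n a s l (sign_seq t)]) <=
   (s ^+ 2 + sqr_sum n a)%:E)%E.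
Proof.
move=> l0; have mI := @measurable_I01 R.
have big_start m (b : nat -> R) r : l < `|r| ->
    ((l ^+ 2)%:E * mu (I01 `&` [set t | sign_max_event m b r l (sign_seq t)]) <=
     (r ^+ 2 + sqr_sum m b)%:E)%E.
  move=> lr; apply: (@le_trans _ _ ((l ^+ 2)%:E * mu I01)%E).
    apply: lee_wpmul2l; first by rewrite lee_fin sqr_ge0.
    by apply: le_measure; rewrite ?inE//; exact: measurable_sign_max_event.
  rewrite lebesgue_measure_I01 mule1 lee_fin ler_wpDr ?sqr_sum_ge0//.
  by rewrite -[leRHS]real_normK ?num_real// ler_sqr ?nnegrE ?(ltW l0)// ltW.
elim: n a s => [|n ih] a s; have [sl|sl] := ltP l `|s|; try exact: big_start.
  rewrite (_ : _ `&` _ = set0) ?measure0 ?mule0 ?lee_fin.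
    by rewrite addr_ge0 ?sqr_ge0 ?sqr_sum_ge0.
  apply/seteqP; split=> // t [_ [m]]; rewrite leqn0 => /eqP ->.
  by rewrite /sign_sum big_ord0 addr0 ltNge sl.
pose H m (b : nat -> R) r (e : nat -> R) : \bar R :=
  (`[< sign_max_event m b r l e >]%:R)%:E.
have HE m b r : (\int[mu]_(t in I01) H m b r (sign_seq t) =
    mu (I01 `&` [set t | sign_max_event m b r l (sign_seq t)]))%E.
  rewrite -[in RHS](setIid I01) -setIA [X in mu X]setIC.
  rewrite -integral_indic//; last exact: measurable_sign_max_event.
  apply: eq_integral => t It; rewrite /H indicE; congr (_%:R%:E)%E.
  congr nat_of_bool; apply/asboolP/idP; rewrite inE => h.
    by split => //; exact: set_mem.
  by case: h.
have mH m b r : measurable_fun I01 (fun t => H m b r (sign_seq t)).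
  apply: (eq_measurable_fun (fun t => (\1_(I01 `&`
    [set t | sign_max_event m b r l (sign_seq t)]) t : R)%:E)).
    move=> t It; rewrite /H indicE; congr (_%:R%:E)%E.
    congr nat_of_bool; apply/idP/asboolP; rewrite inE => h; first by case: h.
    by split => //; exact: set_mem.
  by apply/measurable_EFinP/measurable_indic; exact: measurable_sign_max_event.
have HS x t : H n.+1 a s (scons x (sign_seq t)) =
    H n (behead_seq a) (s + a 0%N * x) (sign_seq t).
  congr (_%:R%:E)%E; congr nat_of_bool; apply/asboolP/asboolP.
    move=> [[_|m mn]]; first by rewrite /sign_sum big_ord0 addr0 ltNge sl.
    by rewrite sign_sum_scons addrA => h; exists m.
  by move=> [m mn h]; exists m.+1 => //; rewrite sign_sum_scons addrA.
rewrite -HE (integral_sign_seq (mH _ _ _)); last by move=> e; rewrite lee_fin ler0n.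
under eq_integral do rewrite HS mulr1.
under [X in (_ + _ * X)%E]eq_integral do rewrite HS mulrN1.
rewrite !HE ge0_muleDr ?mule_ge0 ?lee_fin// !(muleCA (l ^+ 2)%:E).
have h0 : (0 <= (2^-1)%:E :> \bar R)%E by rewrite lee_fin.
apply: le_trans (leeD (lee_wpmul2l h0 (ih _ _)) (lee_wpmul2l h0 (ih _ _))) _.
by rewrite -!EFinM -EFinD lee_fin sqr_sum_recl !sqrrD; lra.
Qed.

(** The density with respect to which the k-th sign has mean b k. *)
Definition riesz_product (n : nat) (b e : nat -> R) : R :=
  \prod_(k < n) (1 + b k * e k).

Lemma riesz_product_scons n b x e :
  riesz_product n.+1 b (scons x e) =
  (1 + b 0%N * x) * riesz_product n (behead_seq b) e.
Proof. by rewrite /riesz_product big_ord_recl. Qed.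

Definition dot (n : nat) (a b : nat -> R) : R := \sum_(k < n) a k * b k.

(** The integral of a Riesz product times an affine function of the signs is
    al + dot n c b. Stating it as a bound for majorants y + q of the integrand
    keeps the integral nonnegative and lets y be any measurable function: the
    induction only halves the integral of y. *)
Lemma riesz_product_duality n (b c : nat -> R) (al q : R) (y : R -> R) :
  (forall k, `|b k| <= 1) -> measurable_fun I01 y ->
  (forall t, 0 <= y t) ->
  (forall t, 0 < t < 1 ->
     riesz_product n b (sign_seq t) * (al + sign_sum n c (sign_seq t)) <=
     y t + q) ->
  ((al + dot n c b - q)%:E <= \int[mu]_(t in I01) (y t)%:E)%E.
Proof.
elim: n b c al y => [|n ih] b c al y b1 my y0 h.
  rewrite /dot big_ord0 addr0.
  apply: (@le_trans _ _ (\int[mu]_(t in I01) (cst (Num.max 0 (al - q))%:E t))%E).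
    rewrite integral_cst ?measurable_I01//= lebesgue_measure_I01 mule1 lee_fin.
    by rewrite le_max lexx orbT.
  apply: ae_ge0_le_integral => //.
  - by move=> t _; rewrite lee_fin le_max lexx.
  - by move=> t _; rewrite lee_fin.
  - by apply/measurable_EFinP.
  apply: ae_I01 => t t01; rewrite lee_fin ge_max y0/= lerBlDr.
  by have := h t t01; rewrite /riesz_product /sign_sum !big_ord0 mul1r addr0.
have bS k : `|behead_seq b k| <= 1 by exact: b1.
have key x (f : R -> R) : measurable_fun I01 (y \o f) ->
    (forall t, 0 < t < 1 -> 0 < f t < 1) ->
    (forall t, 0 < t < 1 -> sign_seq (f t) = scons x (sign_seq t)) ->
    (((1 + b 0%N * x) * (al + c 0%N * x + dot n (behead_seq c) (behead_seq b))
      - q)%:E <= \int[mu]_(t in I01) (y (f t))%:E)%E.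
  move=> mf f01 fE.
  have -> : (1 + b 0%N * x) * (al + c 0%N * x + dot n (behead_seq c) (behead_seq b))
    = (1 + b 0%N * x) * (al + c 0%N * x) +
      dot n (fun k => (1 + b 0%N * x) * behead_seq c k) (behead_seq b).
    rewrite mulrDr /dot mulr_sumr; congr (_ + _).
    by apply: eq_bigr => k _; rewrite mulrA.
  apply: ih => // t t01.
  have := h (f t) (f01 t t01); rewrite fE// riesz_product_scons sign_sum_scons.
  have -> : sign_sum n (fun k => (1 + b 0%N * x) * behead_seq c k) (sign_seq t) =
      (1 + b 0%N * x) * sign_sum n (behead_seq c) (sign_seq t).
    rewrite /sign_sum mulr_sumr.
    by apply: eq_bigr => k _; rewrite mulrA.
  by rewrite -mulrDr addrA mulrCA mulrA.
rewrite integral_halves; last 2 first.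
- by apply/measurable_EFinP.
- by move=> t _; rewrite lee_fin.
have k1 := key 1 (fun t => 2^-1 * t) (measurable_left_half my) _ (@sign_seq_left R).
have k2 := key (- 1) (fun t => 2^-1 * t + 2^-1) (measurable_right_half my) _
  (@sign_seq_right R).
have h0e : (0 <= (2^-1)%:E :> \bar R)%E by rewrite lee_fin.
apply: le_trans (leeD (lee_wpmul2l h0e (k1 _)) (lee_wpmul2l h0e (k2 _))).
- have -> : dot n.+1 c b = c 0%N * b 0%N + dot n (behead_seq c) (behead_seq b).
    by rewrite /dot big_ord_recl.
  rewrite -!EFinM -EFinD lee_fin.
  by move: (dot n _ _) => d; lra.
- by move=> t /andP[t0 t1]; lra.
- by move=> t /andP[t0 t1]; lra.
Qed.

End subgaussian.

(** * Almost everywhere convergence of sign series *)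

Section almost_everywhere_convergence.
Context {R : realType}.
Local Notation mu := (@lebesgue_measure R).
Local Notation I01 := (`[0%R, 1%R]%classic : set R).
Implicit Types a b : nat -> R.

Definition seq_tail (n : nat) a : nat -> R := fun k => if (k < n)%N then 0 else a k.

Lemma sum_seq_tail (F : R -> nat -> R) a n M : (forall k, F 0 k = 0) -> (n <= M)%N ->
  \sum_(k < M) F (seq_tail n a k) k = \sum_(k < M) F (a k) k - \sum_(k < n) F (a k) k.
Proof.
move=> F0 nM; apply/eqP; rewrite eq_sym subr_eq.
rewrite (big_ord_widen _ (fun k => F (a k) k) nM) [X in _ + X]big_mkcond -big_split/=.
apply/eqP; apply: eq_bigr => k _; rewrite /seq_tail.
by case: ifP; rewrite ?F0 ?add0r ?addr0.
Qed.

Lemma sum_seq_tail0 (F : R -> nat -> R) a n M : (forall k, F 0 k = 0) -> (M <= n)%N ->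
  \sum_(k < M) F (seq_tail n a k) k = 0.
Proof.
move=> F0 Mn; rewrite big1// => k _; rewrite /seq_tail.
by rewrite (leq_trans (ltn_ord k) Mn).
Qed.

Lemma sqr_sum_nondecreasing a : nondecreasing_seq (fun n => sqr_sum n a).
Proof.
apply/nondecreasing_seqP => n.
by rewrite /sqr_sum big_ord_recr/= lerDl sqr_ge0.
Qed.

Lemma sqr_sum_tail_small a A e : (forall n, sqr_sum n a <= A) -> 0 < e ->
  exists n, forall m M, (n <= m)%N -> sqr_sum M (seq_tail m a) <= e.
Proof.
move=> aA e0.
have cA : cvgn (fun n => sqr_sum n a).
  apply: nondecreasing_is_cvgn; first exact: sqr_sum_nondecreasing.
  by exists A => _ [n _ <-].
have [k ke] := invS_small e0; have [N hN] := (cvgn_cauchyP _).1 cA k.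
exists N => m M Nm; have [mM|Mm] := leqP m M; last first.
  rewrite /sqr_sum (@sum_seq_tail0 (fun r _ => r ^+ 2)); [exact: ltW| |exact: ltnW].
  by move=> _; rewrite expr0n.
rewrite /sqr_sum (@sum_seq_tail (fun r _ => r ^+ 2))//; last first.
  by move=> _; rewrite expr0n.
apply: le_trans (ltW ke); apply: le_trans (hN M (leq_trans Nm mM)).
apply: le_trans (ler_norm _); rewrite lerB//.
exact: sqr_sum_nondecreasing.
Qed.

(** Where the series diverges, for some k the oscillation beyond every n exceeds
    1 / (k + 1). By the maximal inequality for the tail beyond n this has measure
    at most (k + 1)^2 times the tail of the sum of squares. *)
Lemma sign_sum_ae_cvg a A : (forall n, sqr_sum n a <= A) ->
  {ae mu, forall t, I01 t -> cvgn (fun n => sign_sum n a (sign_seq t))}.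
Proof.
move=> aA.
pose B n k N := I01 `&`
  [set t | sign_max_event N (seq_tail n a) 0 (k.+1%:R^-1) (sign_seq t)].
have mB n k N : measurable (B n k N) by exact: measurable_sign_max_event.
have mUB n k : measurable (\bigcup_N B n k N) by exact: bigcupT_measurable.
pose C k := \bigcap_n \bigcup_N B n k N.
have mC k : measurable (C k) by apply: bigcapT_measurable => n.
have C0 k : mu (C k) = 0%E.
  apply/eqP; rewrite eq_le measure_ge0 andbT.
  apply/lee_addgt0Pr => e e0; rewrite add0e.
  pose l : R := k.+1%:R^-1; have l0 : 0 < l by rewrite invr_gt0.
  have [|n hn] := sqr_sum_tail_small (e := e * l ^+ 2) aA.
    by rewrite mulr_gt0// exprn_gt0.
  apply: (@le_trans _ _ (mu (\bigcup_N B n k N))).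
    apply: le_measure; rewrite ?inE; [exact: mC|exact: mUB|].
    by move=> t Ct; exact: Ct.
  have ndB : nondecreasing_seq (B n k).
    move=> N1 N2 N12; apply/subsetPset => t [It [m mN1 h]]; split => //.
    by exists m => //; exact: leq_trans N12.
  have cB := nondecreasing_cvg_mu (mu := mu) (mB n k) (mUB n k) ndB.
  rewrite -(cvg_lim _ cB)//; apply: lime_le; first by apply/cvg_ex; eexists; exact: cB.
  apply: nearW => N /=; have := sign_maximal_inequality N (seq_tail n a) 0 l0.
  rewrite expr0n add0r => h.
  rewrite -(@lee_pmul2l _ (l ^+ 2)%:E) ?lte_fin ?exprn_gt0//.
  by apply: le_trans h _; rewrite -EFinM lee_fin mulrC hn.
have : mu.-negligible (\bigcup_k C k).
  by apply: negligible_bigcup => k; exists (C k); split; [exact: mC|exact: C0|].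
apply: negligibleS => t /= /not_implyP[It ncv].
apply: contrapT => nC; apply: ncv; apply/cvgn_cauchyP => k.
have /existsNP[n /existsNP[_ hn]] : ~ C k t by move=> Ck; apply: nC; exists k.
exists n => N nN; rewrite leNgt; apply/negP => h; apply: hn.
exists N => //; split => //; exists N => //.
rewrite add0r /sign_sum (@sum_seq_tail (fun r j => r * sign_seq t j))//.
by move=> j; rewrite mul0r.
Qed.

End almost_everywhere_convergence.

(** * The norms of l_1 and l_2 *)

Section sequence_norms.
Context {R : realType}.
Implicit Types a b : nat -> R.

Definition abs_sum (n : nat) a : R := \sum_(k < n) `|a k|.

Lemma nneseries_leP (f : nat -> R) (A : R) : (forall k, 0 <= f k) ->
  (\sum_(k <oo) (f k)%:E <= A%:E)%E <-> forall n, \sum_(k < n) f k <= A.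
Proof.
move=> f0; split=> [h n|h].
  rewrite -lee_fin; apply: le_trans h.
  rewrite -sumEFin -(big_mkord xpredT (fun k => (f k)%:E)).
  by apply: nneseries_lim_ge => k _ _; rewrite lee_fin.
apply: lime_le; first by apply: is_cvg_nneseries => k _ _; rewrite lee_fin.
by apply: nearW => n; rewrite big_mkord sumEFin lee_fin.
Qed.

Lemma l1_norm_leP a A : (lp_norm 1 a <= A%:E)%E <-> forall n, abs_sum n a <= A.
Proof.
rewrite /lp_norm Lnorm1 ge0_integral_count; last by move=> k; exact: abse_ge0.
exact: nneseries_leP.
Qed.

Lemma l2_norm_leP a A : 0 <= A ->
  (lp_norm 2 a <= A%:E)%E <-> forall n, sqr_sum n a <= A ^+ 2.
Proof.
move=> A0; rewrite /lp_norm Lnorm_counting//.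
have -> : (\sum_(k <oo) `|(EFin \o a) k| `^ 2)%E = (\sum_(k <oo) (a k ^+ 2)%:E)%E.
  apply: eq_eseriesr => k _.
  by rewrite poweR_EFin powR_mulrn// real_normK// num_real.
set S := (\sum_(k <oo) _)%E.
have S0 : (0 <= S)%E by apply: nneseries_ge0 => k _ _; rewrite lee_fin sqr_ge0.
have SP : (S <= (A ^+ 2)%:E)%E <-> forall n, sqr_sum n a <= A ^+ 2.
  by apply: nneseries_leP => k; exact: sqr_ge0.
have inI (x : \bar R) : (0 <= x)%E -> x \in `[0%E, +oo%E].
  by move=> x0; rewrite in_itv/= x0 leey.
split=> [h|/SP h].
  apply/SP; rewrite -(poweRe1 S0) -[X in (S `^ X)%E](mulVf (_ : 2 != 0 :> R))//.
  rewrite poweRrM -[leRHS]/((A ^+ 2)%:E) -powR_mulrn// -poweR_EFin.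
  by apply: gt0_ler_poweR; rewrite ?inI ?poweR_ge0 ?lee_fin.
have -> : A%:E = ((A ^+ 2)%:E `^ 2^-1)%E.
  by rewrite poweR_EFin powR12_sqrt ?sqr_ge0// sqrtr_sqr ger0_norm.
by apply: gt0_ler_poweR; rewrite ?inI ?lee_fin ?sqr_ge0 ?invr_ge0.
Qed.

Lemma l1_norm_ge0 a : (0 <= lp_norm 1 a)%E. Proof. exact: Lnorm_ge0. Qed.

Lemma l2_norm_ge0 a : (0 <= lp_norm 2 a)%E. Proof. exact: Lnorm_ge0. Qed.

Lemma l1_seminorm : ext_seminorm (lp_norm (1 : R)).
Proof.
apply: ext_seminorm_criterion.
- exact: l1_norm_ge0.
- apply/le_anti; rewrite l1_norm_ge0 andbT; apply/l1_norm_leP => n.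
  by rewrite /abs_sum big1// => k _; rewrite normr0.
- move=> c a c0; have [a1|] := ltP (lp_norm 1 a) +oo%E; last first.
    by rewrite leye_eq => /eqP->; rewrite gt0_muley ?leey// lte_fin normr_gt0.
  have := ge0_lty_fin (l1_norm_ge0 a) a1; set A := fine _ => aA.
  have /l1_norm_leP hA : (lp_norm 1 a <= A%:E)%E by rewrite -aA.
  rewrite aA -EFinM; apply/l1_norm_leP => n.
  rewrite (_ : abs_sum n (c *: a) = `|c| * abs_sum n a) ?ler_wpM2l//.
  by rewrite /abs_sum mulr_sumr; apply: eq_bigr => k _; rewrite -normrM.
- move=> a b A B /l1_norm_leP hA /l1_norm_leP hB; apply/l1_norm_leP => n.
  apply: le_trans (lerD (hA n) (hB n)); rewrite /abs_sum -big_split/=.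
  by apply: ler_sum => k _; exact: ler_normD.
Qed.

Lemma l2_seminorm : ext_seminorm (lp_norm (2 : R)).
Proof.
apply: ext_seminorm_criterion.
- exact: l2_norm_ge0.
- apply/le_anti; rewrite l2_norm_ge0 andbT; apply/l2_norm_leP => // n.
  by rewrite /sqr_sum big1 ?expr0n// => k _; rewrite expr0n.
- move=> c a c0; have [a2|] := ltP (lp_norm 2 a) +oo%E; last first.
    by rewrite leye_eq => /eqP->; rewrite gt0_muley ?leey// lte_fin normr_gt0.
  have := ge0_lty_fin (l2_norm_ge0 a) a2; set A := fine _ => aA.
  have A0 : 0 <= A by rewrite fine_ge0// l2_norm_ge0.
  have /(l2_norm_leP _ A0) hA : (lp_norm 2 a <= A%:E)%E by rewrite -aA.
  rewrite aA -EFinM; apply/l2_norm_leP => [|n]; first by rewrite mulr_ge0.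
  rewrite (_ : sqr_sum n (c *: a) = `|c| ^+ 2 * sqr_sum n a).
    by rewrite exprMn ler_wpM2l// sqr_ge0.
  rewrite /sqr_sum mulr_sumr; apply: eq_bigr => k _.
  by rewrite real_normK ?num_real// -exprMn.
- move=> a b A B hA hB; rewrite EFinD; apply: le_trans (leeD hA hB).
  apply: (@minkowski_EFin _ _ _ counting a b) => //.
  by rewrite ler1n.
Qed.

Lemma l2_le_l1 a : (lp_norm 2 a <= lp_norm 1 a)%E.
Proof.
have [a1|] := ltP (lp_norm 1 a) +oo%E; last by rewrite leye_eq => /eqP->; rewrite leey.
have := ge0_lty_fin (l1_norm_ge0 a) a1; set A := fine _ => aA.
have A0 : 0 <= A by rewrite fine_ge0// l1_norm_ge0.
have /l1_norm_leP hA : (lp_norm 1 a <= A%:E)%E by rewrite -aA.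
rewrite aA; apply/l2_norm_leP => // n.
have S0 : 0 <= abs_sum n a by apply: sumr_ge0.
apply: (@le_trans _ _ (abs_sum n a ^+ 2)); last by rewrite ler_sqr ?nnegrE.
rewrite /sqr_sum /abs_sum; elim: n {S0} => [|n ih]; first by rewrite !big_ord0 expr0n.
rewrite !big_ord_recr/= sqrrD real_normK ?num_real//.
have : 0 <= (\sum_(k < n) `|a k|) * `|a n| by rewrite mulr_ge0// sumr_ge0.
by lra.
Qed.

End sequence_norms.

(** * Rademacher series *)

Section rademacher_operator.
Context {R : realType}.
Local Notation mu := (@lebesgue_measure R).
Local Notation I01 := (`[0%R, 1%R]%classic : set R).
Implicit Types a b : nat -> R.

Definition rad_partial (n : nat) a (t : R) : R :=
  series (fun k => a k * rademacher k t) n.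

Lemma measurable_rad_partial n a D : measurable_fun D (rad_partial n a).
Proof.
apply: measurable_sum => k; apply: measurable_funM; first exact: measurable_cst.
exact: measurable_rademacher.
Qed.

Lemma rad_partialE n a t : 0 < t < 1 ->
  rad_partial n.+1 a t = a 0%N + sign_sum n (behead_seq a) (sign_seq t).
Proof.
move=> t01; rewrite /rad_partial /series/= big_mkord big_ord_recl.
by rewrite rademacher0// mulr1.
Qed.

Lemma measurable_rademacher_sum a : measurable_fun I01 (rademacher_sum a).
Proof.
apply: measurable_limn => [|n]; first exact: measurable_I01.
exact: measurable_rad_partial.
Qed.

Lemma l2_bound a : in_space (lp_norm 2) a ->
  exists2 A, 0 <= A & forall n, sqr_sum n a <= A ^+ 2.
Proof.
move=> a2; have a0 : (0 <= lp_norm 2 a)%E by exact: Lnorm_ge0.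
exists (fine (lp_norm 2 a)); first exact: fine_ge0.
by apply/l2_norm_leP; [exact: fine_ge0|rewrite -ge0_lty_fin].
Qed.

Lemma rademacher_sum_ae_cvg a : in_space (lp_norm 2) a ->
  {ae mu, forall t, I01 t -> rad_partial n a t @[n --> \oo] --> rademacher_sum a t}.
Proof.
move=> /l2_bound[A A0 aA].
have bA n : sqr_sum n (behead_seq a) <= A ^+ 2.
  by apply: le_trans (aA n.+1); rewrite sqr_sum_recl lerDr sqr_ge0.
apply: aeS2 (sign_sum_ae_cvg bA) (ae_I01 (P := fun t => 0 < t < 1) (fun t h => h)).
move=> t h h01 It; have t01 := h01 It; have := h It.
move=> /cvg_ex[l hl].
have : cvgn (fun n => rad_partial n a t).
  apply/cvg_ex; exists (a 0%N + l).
  rewrite -(cvg_shiftS (fun n => rad_partial n a t)).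
  under eq_fun do rewrite rad_partialE//.
  by apply: cvgD => //; exact: cvg_cst.
by [].
Qed.

End rademacher_operator.

(** * The upper estimate for the K-functional of a Rademacher sum *)

Local Opaque lp_norm.

Section rademacher_bounds.
Context {R : realType}.
Local Notation mu := (@lebesgue_measure R).
Local Notation I01 := (`[0%R, 1%R]%classic : set R).
Implicit Types a b : nat -> R.

Lemma rademacher_sum_ae_add a b :
  in_space (lp_norm 2) a -> in_space (lp_norm 2) b ->
  {ae mu, forall t, I01 t ->
     rademacher_sum (a + b) t = rademacher_sum a t + rademacher_sum b t}.
Proof.
move=> a2 b2; apply: aeS2 (rademacher_sum_ae_cvg a2) (rademacher_sum_ae_cvg b2).
move=> t ha hb It; apply: cvg_lim => //.
have -> : series (fun k => (a + b) k * rademacher k t) =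
    (fun n => rad_partial n a t + rad_partial n b t).
  apply/funext => n; rewrite /rad_partial /series/= -big_split/=.
  by apply: eq_bigr => k _; rewrite mulrDl.
by apply: cvgD; [exact: ha|exact: hb].
Qed.

Lemma rademacher_le1 k (t : R) : `|rademacher k t| <= 1.
Proof. by rewrite normr_sg; case: (_ != 0); rewrite ?ler01. Qed.

Lemma Linfty_rademacher_sum a : (Linfty_norm (rademacher_sum a) <= lp_norm 1 a)%E.
Proof.
have [a1|] := ltP (lp_norm 1 a) +oo%E; last by rewrite leye_eq => /eqP->; rewrite leey.
have a2 : in_space (lp_norm 2) a := le_lt_trans (l2_le_l1 a) a1.
have := ge0_lty_fin (l1_norm_ge0 a) a1; set A := fine _ => aA.
have A0 : 0 <= A by rewrite fine_ge0// l1_norm_ge0.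
have /l1_norm_leP hA : (lp_norm 1 a <= A%:E)%E by rewrite -aA.
rewrite aA; apply/Linfty_leP => //; first exact: measurable_rademacher_sum.
apply: aeS (rademacher_sum_ae_cvg a2) => t /[apply] /cvg_norm ct.
rewrite -(cvg_lim _ ct)//; apply: limr_le; first by apply/cvg_ex; eexists; exact: ct.
apply: nearW => n; apply: le_trans (hA n).
rewrite /rad_partial /series/= big_mkord /abs_sum.
apply: le_trans (ler_norm_sum _ _ _) _; apply: ler_sum => k _.
by rewrite normrM ler_piMr// rademacher_le1.
Qed.

(** The constant term of the Rademacher sum is the start of the sign sum. *)
Lemma gauss_modular_rad_partial n a A v :
  0 < v -> 4 * A <= v -> 0 <= A -> sqr_sum n.+1 a <= A ^+ 2 ->
  (gauss_modular (rad_partial n.+1 a) v <= 1)%E.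
Proof.
move=> v0 Av A0; rewrite sqr_sum_recl; set q := sqr_sum n _ => aA.
have q0 : 0 <= q := sqr_sum_ge0 _ _; have a0 := sqr_ge0 (a 0%N).
have mI := @measurable_I01 R.
pose b := v ^- 2; have b0 : 0 <= b by rewrite invr_ge0 exprn_ge0// ltW.
have bA : 16 * b * (a 0%N ^+ 2 + q) <= 1.
  rewrite mulrAC ler_pdivrMr ?exprn_gt0// mul1r.
  have : (4 * A) ^+ 2 <= v ^+ 2 by rewrite ler_sqr ?nnegrE ?mulr_ge0// ltW.
  by lra.
have bq0 : 0 <= b * q by rewrite mulr_ge0.
have ba0 : 0 <= b * a 0%N ^+ 2 by rewrite mulr_ge0.
have bq : 16 * b * q <= 1 by move: bA; rewrite mulrDr; lra.
have mr : measurable_fun I01 (rad_partial n.+1 a) by exact: measurable_rad_partial.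
have mG := measurable_gauss_young v mr.
have : (gauss_modular (rad_partial n.+1 a) v + 1 <= 1 + 1)%E; last first.
  by rewrite leeD2rE.
apply: (@le_trans _ _ (\int[mu]_(t in I01)
    (expR (b * (a 0%N + sign_sum n (behead_seq a) (sign_seq t)) ^+ 2))%:E)%E).
  apply: (@le_trans _ _ (\int[mu]_(t in I01)
    ((gauss_young (`|rad_partial n.+1 a t| / v))%:E + (cst 1%E) t))%E).
    rewrite ge0_integralD//; last by move=> t _; rewrite lee_fin gauss_young_ge0.
    by rewrite integral_cst//= lebesgue_measure_I01 mule1.
  apply: ae_ge0_le_integral => //.
  - by move=> t _; rewrite adde_ge0// lee_fin gauss_young_ge0.
  - exact: emeasurable_funD.
  - apply/measurable_EFinP; apply: measurableT_comp => //.
    apply: measurable_funM => //; apply: measurable_funX.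
    by apply: measurable_funD => //; exact: measurable_sign_sum.
  apply: ae_I01 => t t01; rewrite /= -EFinD lee_fin /gauss_young subrK ler_expR.
  by rewrite exprMn real_normK ?num_real// rad_partialE// mulrC exprVn.
apply: le_trans (integral_gauss_sign_sum _ b0 bq) _.
rewrite -/q -EFinD lee_fin.
apply: (@le_trans _ _ (expR (8^-1))).
  rewrite ler_expR.
  have D0 : 0 < 1 - 8 * b * q by lra.
  have h : b / (1 - 8 * b * q) <= 2 * b by rewrite ler_pdivrMr//; nra.
  have := ler_wpM2r a0 h; rewrite mulrDr in bA.
  by move: (b / _ * _) => B hB; lra.
have := expR_ge1Dx (- 8^-1 : R); rewrite expRN => h1.
have e0 := expR_gt0 (8^-1 : R).
have : expR (8^-1) * (1 - 8^-1) <= 1 :> R by rewrite -ler_pdivlMl// mulr1.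
by lra.
Qed.

(** Boundedness of the Rademacher operator from l_2, by Fatou's lemma from its
    partial sums. *)
Lemma LN_rademacher_sum a : (LN_norm (rademacher_sum a) <= 4%:E * lp_norm 2 a)%E.
Proof.
have [a2|] := ltP (lp_norm 2 a) +oo%E; last first.
  by rewrite leye_eq => /eqP->; rewrite gt0_muley ?leey// lte_fin.
have := ge0_lty_fin (l2_norm_ge0 a) a2; set A := fine _ => aA.
have A0 : 0 <= A by rewrite fine_ge0// l2_norm_ge0.
have /(l2_norm_leP _ A0) hA : (lp_norm 2 a <= A%:E)%E by rewrite -aA.
rewrite aA -EFinM; apply: LN_le_of_gt; first by rewrite mulr_ge0.
  exact: measurable_rademacher_sum.
move=> v Av; have v0 : 0 < v by apply: le_lt_trans Av; rewrite mulr_ge0.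
apply: (@gauss_modular_fatou _ (fun n => rad_partial n.+1 a)).
- by move=> n; exact: measurable_rad_partial.
- exact: measurable_rademacher_sum.
- apply: aeS (rademacher_sum_ae_cvg a2) => t /[apply] h.
  by rewrite (cvg_shiftS (fun n => rad_partial n a t)).
by move=> n; apply: gauss_modular_rad_partial (hA n.+1); rewrite // ltW.
Qed.

Definition seq_take (n : nat) a : nat -> R := fun k => if (k < n)%N then a k else 0.

Lemma seq_take_tail n a : seq_take n a + seq_tail n a = a.
Proof.
apply/funext => k; rewrite -[LHS]/(seq_take n a k + seq_tail n a k).
by rewrite /seq_take /seq_tail; case: ifP; rewrite ?addr0 ?add0r.
Qed.

Lemma ler_sum_support (F : nat -> R) n m : (forall k, 0 <= F k) ->
  (forall k, (n <= k)%N -> F k = 0) -> \sum_(k < m) F k <= \sum_(k < n) F k.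
Proof.
move=> F0 Fn.
apply: (@le_trans _ _ (\sum_(k < n + m) F k)).
  by rewrite addnC big_split_ord/= lerDl sumr_ge0.
rewrite big_split_ord/= -[leRHS]addr0 lerD2l big1// => k _.
by rewrite Fn// leq_addr.
Qed.

Lemma l1_seq_take n a : in_space (lp_norm 1) (seq_take n a).
Proof.
rewrite /in_space; apply: (@le_lt_trans _ _ (abs_sum n (seq_take n a))%:E).
  apply/l1_norm_leP => m.
  apply: (ler_sum_support (F := fun k => `|seq_take n a k|)) => [k|k nk] //.
  by rewrite /seq_take ltnNge nk normr0.
by rewrite ltry.
Qed.

Lemma l2_seq_take n a : in_space (lp_norm 2) (seq_take n a).
Proof. exact: le_lt_trans (l2_le_l1 _) (l1_seq_take n a). Qed.

Lemma l2_tail_small a e : in_space (lp_norm 2) a -> 0 < e ->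
  exists n, forall m, (n <= m)%N -> (lp_norm 2 (seq_tail m a) <= e%:E)%E.
Proof.
move=> /l2_bound[A A0 aA] e0.
have [|n hn] := sqr_sum_tail_small (e := e ^+ 2) aA; first by rewrite exprn_gt0.
exists n => m nm; apply/l2_norm_leP => [|M]; [exact: ltW|exact: hn].
Qed.

Lemma l2_seq_tail n a : in_space (lp_norm 2) a -> in_space (lp_norm 2) (seq_tail n a).
Proof.
move=> a2; have -> : seq_tail n a = a + - seq_take n a.
  by apply/eqP; rewrite eq_sym subr_eq addrC seq_take_tail.
apply (in_spaceD (@l2_seminorm R) a2).
rewrite /in_space (seminormN (@l2_seminorm R)); exact: l2_seq_take.
Qed.

Lemma rademacher_sum_tail n a : in_space (lp_norm 2) a ->
  {ae mu, forall t, I01 t -> rademacher_sum (seq_tail n a) t =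
    (rademacher_sum a - rademacher_sum (seq_take n a)) t}.
Proof.
move=> a2.
have := rademacher_sum_ae_add (l2_seq_take n a) (l2_seq_tail n a2).
rewrite seq_take_tail; apply: aeS => t /[apply] h.
rewrite -[RHS]/(rademacher_sum a t - rademacher_sum (seq_take n a) t) h.
by rewrite addrAC subrr add0r.
Qed.

Lemma measurable_rademacher_sumB a b :
  measurable_fun I01 (rademacher_sum a - rademacher_sum b).
Proof. by apply: measurable_funB; exact: measurable_rademacher_sum. Qed.

Lemma LN_rademacher_tail n a : in_space (lp_norm 2) a ->
  (LN_norm (rademacher_sum a - rademacher_sum (seq_take n a))%R <=
   4%:E * lp_norm 2 (seq_tail n a))%E.
Proof.
move=> a2; rewrite -(LN_ae_eq _ _ (rademacher_sum_tail n a2)).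
- exact: LN_rademacher_sum.
- exact: measurable_rademacher_sum.
- exact: measurable_rademacher_sumB.
Qed.

(** The partial sums are bounded functions, and they converge in the Orlicz norm
    because the l_2 norms of the tails of a tend to 0. *)
Lemma in_G_rademacher_sum a : in_space (lp_norm 2) a -> in_G (rademacher_sum a).
Proof.
move=> a2; split.
  apply: le_lt_trans (LN_rademacher_sum a) _.
  by rewrite lte_mul_pinfty// lee_fin.
move=> e e0; have [|n hn] := l2_tail_small (e := e / 8) a2; first by rewrite divr_gt0.
exists (rademacher_sum (seq_take n a)).
  exact: le_lt_trans (Linfty_rademacher_sum _) (l1_seq_take n a).
apply: le_lt_trans (LN_rademacher_tail n a2) _.
apply: (@le_lt_trans _ _ (4%:E * (e / 8)%:E)%E).
  by apply: lee_wpmul2l; [rewrite lee_fin|exact: hn].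
by rewrite -EFinM lte_fin; lra.
Qed.

(** A decomposition of a is mapped to one of its Rademacher sum. The second
    summand is defined as a difference, since the series is additive only almost
    everywhere while decompositions are pointwise equalities. *)
Lemma K_rademacher_sum_le (t : R) a : 0 <= t ->
  (K_functional Linfty_norm G_norm t (rademacher_sum a) <=
   4%:E * K_functional (lp_norm 1) (lp_norm 2) t a)%E.
Proof.
move=> t0; apply: (le_K_functional (@Linfty_seminorm R) (@G_seminorm R)
  (@l1_seminorm R) (@l2_seminorm R)) => // a0 a1 aE a01 a12.
have a02 : in_space (lp_norm 2) a0 := le_lt_trans (l2_le_l1 a0) a01.
have a2 : in_space (lp_norm 2) a.
  by rewrite aE; exact (in_spaceD (@l2_seminorm R) a02 a12).
exists (rademacher_sum a0), (rademacher_sum a - rademacher_sum a0).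
split; first by rewrite addrC subrK.
  apply: le_trans (Linfty_rademacher_sum a0) _.
  by rewrite -[leLHS]mul1e lee_wpmul2r ?l1_norm_ge0// lee_fin ler1n.
have xG : in_G (rademacher_sum a - rademacher_sum a0).
  rewrite -scaleN1r; apply: in_GD; first exact: in_G_rademacher_sum.
  by apply: in_GZ; exact: in_G_rademacher_sum.
rewrite (G_normE xG) -(@LN_ae_eq _ (rademacher_sum a1)).
- exact: LN_rademacher_sum.
- exact: measurable_rademacher_sum.
- exact: measurable_rademacher_sumB.
have := rademacher_sum_ae_add a02 a12; rewrite -aE; apply: aeS => r /[apply] h.
rewrite -[RHS]/(rademacher_sum a r - rademacher_sum a0 r) h.
by rewrite addrAC subrr add0r.
Qed.

End rademacher_bounds.

(** * The lower estimate for the K-functional of a Rademacher sum *)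

Section rademacher_lower_bound.
Context {R : realType}.
Local Notation mu := (@lebesgue_measure R).
Local Notation I01 := (`[0%R, 1%R]%classic : set R).
Implicit Types (a b c : nat -> R).

(** The upper bound replaces the logarithm of the Riesz product by the sign sum
    with the same coefficients. *)
Lemma riesz_product_bounds n b e : (forall k, `|b k * e k| <= 1) ->
  0 <= riesz_product n b e <= expR (sign_sum n b e).
Proof.
move=> be; rewrite /riesz_product /sign_sum; elim: n => [|n /andP[ih0 ih1]].
  by rewrite !big_ord0 expR0 ler01 lexx.
have := be n; rewrite ler_norml => /andP[h _].
rewrite !big_ord_recr/= mulr_ge0//=; last by lra.
rewrite expRD ler_pM// ?expR_ge1Dx//; lra.
Qed.

Lemma measurable_riesz_product n b D :
  measurable_fun D (fun t => riesz_product n b (sign_seq t)).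
Proof.
apply: measurable_prod => k _; apply: measurable_funD => //.
by apply: measurable_funM => //; exact: measurable_sign_seq.
Qed.

(** Young's inequality g h <= g log g - g + exp(h), with any upper bound L for
    log g. *)
Lemma riesz_young (g L h : R) : 0 <= g -> g <= expR L -> g * (h - L + 1) <= expR h.
Proof.
move=> g0 gL; have [h1|h1] := leP (h - L + 1) 0.
  by apply: le_trans (expR_ge0 _); rewrite mulr_ge0_le0.
apply: (@le_trans _ _ (expR L * (h - L + 1))); first by rewrite ler_wpM2r// ltW.
have -> : expR h = expR L * expR (h - L) by rewrite -expRD addrC subrK.
by rewrite ler_wpM2l ?expR_ge0// addrC expR_ge1Dx.
Qed.

(** The pairing is the integral of x0 + x1 against the Riesz product g of b. With
    p = |x1| / u, the bound p <= (ta + p^2 / ta) / 2 and Young's inequality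
    reduce g |x1| to g, g L and exp(p^2), where L is the sign sum of b; the
    integral of g L is sum b_k^2 <= ta^2. *)
Lemma dot_le_decomposition N c b x0 x1 (ta u : R) :
  1 <= ta -> 0 < u -> (forall k, `|b k| <= 1) -> sqr_sum N b <= ta ^+ 2 ->
  in_space Linfty_norm x0 -> measurable_fun I01 x1 ->
  (gauss_modular x1 u <= 1)%E ->
  (forall t, 0 < t < 1 ->
     c 0%N + sign_sum N (behead_seq c) (sign_seq t) = x0 t + x1 t) ->
  c 0%N + dot N (behead_seq c) b <= fine (Linfty_norm x0) + 3 / 2 * ta * u.
Proof.
move=> ta1 u0 b1 bta x0i mx1 x1u xE; set M := fine _.
have mx0 := Linfty_measurable x0i; have x0M := Linfty_ae_bound x0i.
have ta0 : 0 < ta by exact: lt_le_trans ta1.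
pose w := u / (2 * ta); have w0 : 0 < w by rewrite divr_gt0// mulr_gt0.
pose g t := riesz_product N b (sign_seq t).
have be t k : `|b k * sign_seq t k| <= 1.
  by rewrite normrM mulr_ile1//; exact: rademacher_le1.
have g0 t : 0 <= g t by have /andP[] := riesz_product_bounds N (be t).
have gL t : g t <= expR (sign_sum N b (sign_seq t)).
  by have /andP[] := riesz_product_bounds N (be t).
(* The last term of y vanishes almost everywhere; it makes the pointwise bound
   on x0 hold at every point. *)
pose y t := w * gauss_young (`|x1 t| / u) + g t * Num.max 0 (`|x0 t| - M).
have mG := measurable_gauss_young u mx1.
have my : measurable_fun I01 y.
  apply: measurable_funD.
    by apply: measurable_funM => //; exact/measurable_EFinP.
  apply: measurable_funM; first exact: measurable_riesz_product.
  apply: measurable_maxr => //; apply: measurable_funB => //.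
  exact: measurableT_comp.
have y0 t : 0 <= y t.
  apply: addr_ge0; apply: mulr_ge0; rewrite ?gauss_young_ge0 ?(ltW w0)//.
  by rewrite le_max lexx.
have iy : (\int[mu]_(t in I01) (y t)%:E <= w%:E)%E.
  apply: (@le_trans _ _ (\int[mu]_(t in I01)
      (w%:E * (gauss_young (`|x1 t| / u))%:E))%E); last first.
    rewrite ge0_integralZl_EFin ?(ltW w0)//; last first.
      by move=> t _; rewrite lee_fin gauss_young_ge0.
    by rewrite -[leRHS]mule1; apply: lee_wpmul2l; rewrite ?lee_fin ?(ltW w0).
  apply: ae_ge0_le_integral.
  - exact: measurable_I01.
  - by move=> t _; rewrite lee_fin.
  - by apply/measurable_EFinP.
  - by move=> t _; rewrite -EFinM lee_fin mulr_ge0 ?gauss_young_ge0 ?(ltW w0).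
  - exact: measurable_funeM.
  apply: aeS x0M => t /[apply] h; rewrite -EFinM lee_fin /y.
  by rewrite (max_idPl _) ?mulr0 ?addr0// subr_le0.
pose al := c 0%N - M - u * ta / 2 + w.
pose d k := behead_seq c k - w * b k.
have key := @riesz_product_duality _ N b d al w y b1 my y0.
have : al + dot N d b - w <= w.
  rewrite -lee_fin; apply: le_trans iy; apply: key => t t01.
  have -> : sign_sum N d (sign_seq t) =
      sign_sum N (behead_seq c) (sign_seq t) - w * sign_sum N b (sign_seq t).
    rewrite /sign_sum mulr_sumr -sumrB; apply: eq_bigr => k _.
    by rewrite /d mulrBl mulrA.
  set L := sign_sum N b _; set p := `|x1 t| / u.
  have cE := xE t t01.
  rewrite -/(g t).
  have p0 : 0 <= p by rewrite divr_ge0// ltW.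
  have x1p : `|x1 t| = u * p by rewrite /p mulrC divfK// gt_eqF.
  have am : u * p <= u * ta / 2 + w * p ^+ 2.
    have -> : u * ta / 2 + w * p ^+ 2 = u * p + w * (ta - p) ^+ 2.
      by rewrite /w; field; rewrite gt_eqF.
    by rewrite lerDl mulr_ge0 ?sqr_ge0 ?(ltW w0).
  have x0m : x0 t <= M + Num.max 0 (`|x0 t| - M).
    have : `|x0 t| - M <= Num.max 0 (`|x0 t| - M) by rewrite le_max lexx orbT.
    by have := ler_norm (x0 t); lra.
  have x1l := ler_norm (x1 t).
  have Y := riesz_young (p ^+ 2) (g0 t) (gL t); rewrite -/L in Y.
  have := ler_wpM2l (ltW w0) Y.
  rewrite /y -/p /gauss_young; set m := Num.max 0 _ in x0m *.
  have : g t * (al + (sign_sum N (behead_seq c) (sign_seq t) - w * L)) <=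
      g t * (m + w * (p ^+ 2 - L + 1)).
    by apply: ler_wpM2l => //; rewrite /al; lra.
  by move: (expR _) => eh; lra.
have -> : dot N d b = dot N (behead_seq c) b - w * sqr_sum N b.
  rewrite /dot /sqr_sum mulr_sumr -sumrB; apply: eq_bigr => k _.
  by rewrite /d mulrBl expr2 mulrA.
have : w * sqr_sum N b <= u * ta / 2.
  have -> : u * ta / 2 = w * ta ^+ 2 by rewrite /w; field; rewrite gt_eqF.
  by rewrite ler_wpM2l// ltW.
have : w <= u * ta / 2.
  rewrite /w ler_pdivrMr ?mulr_gt0//.
  have -> : u * ta / 2 * (2 * ta) = u * ta ^+ 2 by field.
  by rewrite ler_peMr ?(ltW u0)// exprn_ege1.
by rewrite /al; lra.
Qed.

(** The constant term carries no sign; replacing b by -b when it is negative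
    gives it the weight 1 in absolute value. *)
Lemma abs_dot_le_decomposition N c b x0 x1 (ta u : R) :
  1 <= ta -> 0 < u -> (forall k, `|b k| <= 1) -> sqr_sum N b <= ta ^+ 2 ->
  in_space Linfty_norm x0 -> measurable_fun I01 x1 ->
  (gauss_modular x1 u <= 1)%E ->
  (forall t, 0 < t < 1 ->
     c 0%N + sign_sum N (behead_seq c) (sign_seq t) = x0 t + x1 t) ->
  `|c 0%N| + dot N (behead_seq c) b <= fine (Linfty_norm x0) + 3 / 2 * ta * u.
Proof.
move=> ta1 u0 b1 bta x0i mx1 x1u xE; case: (ger0P (c 0%N)) => c0.
  exact: dot_le_decomposition xE.
have -> : - c 0%N + dot N (behead_seq c) b =
    (- c) 0%N + dot N (behead_seq (- c)) (- b).
  by congr (_ + _); apply: eq_bigr => k _; rewrite -[RHS]mulrNN !opprK.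
rewrite -(seminormN (@Linfty_seminorm R) x0).
apply: (@dot_le_decomposition N (- c) (- b) (- x0) (- x1) ta u ta1 u0).
- by move=> k; rewrite -[(- b) k]/(- b k) normrN.
- suff -> : sqr_sum N (- b) = sqr_sum N b by exact: bta.
  by apply: eq_bigr => k _; rewrite -[(- b) k]/(- b k) sqrrN.
- by rewrite /in_space (seminormN (@Linfty_seminorm R)).
- exact: measurable_funN.
- suff -> : gauss_modular (- x1) u = gauss_modular x1 u by exact: x1u.
  by apply: eq_integral => t _; rewrite -[(- x1) t]/(- x1 t) normrN.
move=> t t01; rewrite -[RHS]/(- x0 t - x1 t) -opprD -xE// opprD.
congr (_ + _); rewrite /sign_sum -sumrN; apply: eq_bigr => k _.
by rewrite -mulNr.
Qed.

Lemma norm_clip (l r : R) : 0 <= l -> `|clip l r| = Num.min l `|r|.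
Proof.
move=> l0; rewrite /clip; case: (leP l r) => lr.
  have r0 : 0 <= r := le_trans l0 lr.
  rewrite (max_idPr _); last by rewrite (le_trans _ l0)// oppr_le0.
  by rewrite !ger0_norm// (min_idPl _).
case: (leP (- l) r) => rl.
  by rewrite (min_idPr _)// ler_norml rl ltW.
rewrite normrN ger0_norm// (min_idPl _)//.
by rewrite ltr0_norm; lra.
Qed.

(** With b = clip l r / l, the pairing r b splits into the part of r above the
    level l, which is what the l_1 norm sees, and l times the square of b. *)
Lemma clip_split (l r : R) : 0 < l ->
  r * (clip l r / l) = `|r - clip l r| + l * (clip l r / l) ^+ 2.
Proof.
move=> l0; rewrite /clip; case: (leP l r) => lr.
  rewrite (max_idPr _); last by lra.
  rewrite divff ?gt_eqF// mulr1 expr1n mulr1 ger0_norm ?subr_ge0//.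
  by rewrite subrK.
case: (leP (- l) r) => rl.
  by rewrite subrr normr0 add0r; field; rewrite gt_eqF.
rewrite mulNr divff ?gt_eqF// mulrN1 sqrrN expr1n mulr1 opprK.
by rewrite ltr0_norm; lra.
Qed.

(** Level at which the truncated sequence divided by the level has sum of squares
    of order ta^2. Halving the level multiplies that sum by at most 4, so that the
    last admissible dyadic level works; when all levels are admissible, a level so
    small that the truncated part is negligible is taken. *)
Lemma clip_level n c (ta eta : R) : 1 <= ta -> 0 < eta ->
  let phi (l : R) := sqr_sum n (fun k => clip l (c k) / l) in
  exists l : R, [/\ 0 < l, phi l <= ta ^+ 2 &
    ta ^+ 2 <= 4 * phi l \/ l * ta ^+ 2 <= eta].
Proof.
move=> ta1 eta0 phi; have ta0 : 0 < ta by exact: lt_le_trans ta1.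
have ta2 : 0 < ta ^+ 2 by rewrite exprn_gt0.
(* l0 ^+ 2 is at least the sum of squares, so the level l0 is admissible. *)
pose l0 := 1 + sqr_sum n c; have S0 := sqr_sum_ge0 n c.
have l00 : 0 < l0 by rewrite ltr_wpDr.
pose l (j : nat) : R := l0 * 2^-1 ^+ j.
have lp j : 0 < l j by rewrite mulr_gt0// exprn_gt0// half_gt0.
have P0 : phi (l 0%N) <= ta ^+ 2.
  apply: (@le_trans _ _ 1); last by rewrite exprn_ege1.
  rewrite /l expr0 mulr1 /phi /sqr_sum.
  apply: (@le_trans _ _ (sqr_sum n c / l0 ^+ 2)).
    rewrite /sqr_sum mulr_suml; apply: ler_sum => k _.
    rewrite expr_div_n ler_wpM2r ?invr_ge0 ?exprn_ge0 ?(ltW l00)//.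
    rewrite -[leLHS]real_normK ?num_real// -[leRHS]real_normK ?num_real//.
    by rewrite ler_sqr ?nnegrE// norm_clip ?(ltW l00)// ge_min lexx orbT.
  rewrite ler_pdivrMr ?exprn_gt0// mul1r expr2.
  by apply: le_trans (ler_peMr (ltW l00) _); rewrite /l0; lra.
have step j : phi (l j.+1) <= 4 * phi (l j).
  rewrite /phi /sqr_sum mulr_sumr; apply: ler_sum => k _.
  have lE : l j = 2 * l j.+1 by rewrite /l exprS; field.
  have h : `|clip (l j.+1) (c k)| <= `|clip (l j) (c k)|.
    rewrite !norm_clip ?(ltW (lp _))// lE le_min ge_min ge_min lexx orbT andbT.
    by apply/orP; left; have := lp j.+1; lra.
  have -> : 4 * (clip (l j) (c k) / l j) ^+ 2 = (clip (l j) (c k) / l j.+1) ^+ 2.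
    by move: (clip (l j) _) => X; rewrite lE; field; rewrite gt_eqF.
  rewrite !expr_div_n ler_wpM2r ?invr_ge0 ?exprn_ge0 ?(ltW (lp _))//.
  rewrite -[leLHS]real_normK ?num_real// -[leRHS]real_normK ?num_real//.
  by rewrite ler_sqr ?nnegrE.
have [all_le|] := pselect (forall j, phi (l j) <= ta ^+ 2).
  have [|j hj] := @half_expn_small R (eta / (l0 * ta ^+ 2)).
    by rewrite divr_gt0// mulr_gt0.
  exists (l j); split => //; right; rewrite /l mulrAC mulrC.
  by rewrite -ler_pdivlMr ?mulr_gt0// ltW// hj.
move=> /existsNP[j /negP]; rewrite -ltNge => hj.
have ex : exists j, ta ^+ 2 < phi (l j) by exists j.
case: (ex_minnP ex) => -[|i] hi imin; first by move: hi; rewrite ltNge P0.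
exists (l i); split => //.
  by rewrite leNgt; apply/negP => /imin; rewrite ltnn.
by left; apply: le_trans (ltW hi) (step i).
Qed.

Lemma rademacher_sum_take n a t : 0 < t < 1 ->
  rademacher_sum (seq_take n.+1 a) t =
  a 0%N + sign_sum n (behead_seq a) (sign_seq t).
Proof.
move=> t01; rewrite -rad_partialE//; apply: lim_near_cst => //.
exists n.+1 => // m /= nm.
rewrite /rad_partial /series/= !big_mkord.
rewrite (big_ord_widen _ (fun k => a k * rademacher k t) nm) [RHS]big_mkcond/=.
by apply: eq_bigr => k _; rewrite /seq_take; case: ifP; rewrite ?mul0r.
Qed.

(** At the level l of [clip_level], the sequence splits into its excess over l,
    of l_1 norm A, and its truncation, of l_2 norm at most l ta. Hence its
    K-functional is at most A + l ta^2, up to a small error at most four times the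
    pairing A + l phi, which [abs_dot_le_decomposition] bounds. *)
Lemma K_rademacher_take_ge n a (ta : R) x0 x1 : 1 <= ta ->
  in_space Linfty_norm x0 -> in_space G_norm x1 ->
  rademacher_sum (seq_take n.+1 a) = x0 + x1 ->
  (K_functional (lp_norm 1) (lp_norm 2) ta (seq_take n.+1 a) <=
   6%:E * (Linfty_norm x0 + ta%:E * G_norm x1))%E.
Proof.
move=> ta1 x0i /in_space_G x1G TE; set c := seq_take n.+1 a.
have ta0 : 0 < ta by exact: lt_le_trans ta1.
rewrite (G_normE x1G) (ge0_lty_fin (Linfty_ge0 x0) x0i).
rewrite (ge0_lty_fin (LN_ge0 x1) x1G.1).
set M := fine (Linfty_norm x0); set U := fine (LN_norm x1).
rewrite [leRHS](_ : _ = (6 * (M + ta * U))%:E)//.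
have M0 : 0 <= M by rewrite fine_ge0// Linfty_ge0.
have U0 : 0 <= U by rewrite fine_ge0// LN_ge0.
apply/lee_addgt0Pr => e e0.
pose u := U + e / (12 * ta).
have u0 : 0 < u by rewrite ltr_wpDl// divr_gt0// mulr_gt0.
have e20 : 0 < e / 2 by rewrite divr_gt0.
have [|mx1 _ x1u] := @LN_lt_modular _ x1 u.
  by rewrite (ge0_lty_fin (LN_ge0 x1) x1G.1) lte_fin ltrDl divr_gt0// mulr_gt0.
have [l [l0 phi_le phi_ge]] := clip_level n.+1 c ta1 e20.
pose b k := clip l (c k) / l; rewrite -/b in phi_le phi_ge.
have b1 k : `|b k| <= 1.
  rewrite normrM normfV (gtr0_norm l0) ler_pdivrMr// mul1r.
  by rewrite clip_le// ltW.
pose c1 k := clip l (c k); pose c0 k := c k - clip l (c k).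
have cE : c = c0 + c1 by apply/funext => k; rewrite -[RHS]/(c0 k + c1 k) subrK.
have csupp k : (n.+1 <= k)%N -> c k = 0.
  by move=> nk; rewrite /c /seq_take ltnNge nk.
have clip0 : clip l 0 = 0.
  by apply/eqP; rewrite -normr_eq0 norm_clip ?(ltW l0)// normr0 (min_idPr _)// ltW.
set phi := sqr_sum n.+1 b in phi_le phi_ge.
have B : abs_sum n.+1 c0 + l * phi <= M + 3 / 2 * ta * u.
  apply: (@le_trans _ _ (`|c 0%N| + dot n (behead_seq c) (behead_seq b))).
    have -> : abs_sum n.+1 c0 + l * phi = dot n.+1 c b.
      rewrite /abs_sum /phi /sqr_sum mulr_sumr -big_split/=.
      by apply: eq_bigr => k _; rewrite -clip_split.
    rewrite /dot big_ord_recl/= lerD2r.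
    by apply: le_trans (ler_norm _) _; rewrite normrM ler_piMr.
  apply: (abs_dot_le_decomposition ta1 u0 _ _ x0i mx1 x1u).
  - by move=> k; exact: b1.
  - apply: le_trans phi_le; rewrite /phi sqr_sum_recl lerDr; exact: sqr_ge0.
  move=> t t01; have := congr1 (fun f => f t) TE.
  rewrite rademacher_sum_take// => TEt; rewrite -[RHS]/((x0 + x1) t) -TEt.
  congr (_ + _); apply: eq_bigr => k _.
  by rewrite /behead_seq /c /seq_take ltnS ltn_ord.
have c01 : (lp_norm 1 c0 <= (abs_sum n.+1 c0)%:E)%E.
  apply/l1_norm_leP => m; apply: (ler_sum_support (F := fun k => `|c0 k|)) => [k|k nk] //.
  by rewrite /c0 csupp// clip0 subrr normr0.
have c12 : (lp_norm 2 c1 <= (l * ta)%:E)%E.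
  apply/l2_norm_leP => [|m]; first by rewrite mulr_ge0 ?ltW.
  apply: (@le_trans _ _ (sqr_sum n.+1 c1)).
    apply: (ler_sum_support (F := fun k => c1 k ^+ 2)) => [k|k nk].
      exact: sqr_ge0.
    by rewrite /c1 csupp// clip0 expr0n.
  rewrite (_ : sqr_sum n.+1 c1 = l ^+ 2 * phi).
    by rewrite exprMn ler_wpM2l// sqr_ge0.
  rewrite /phi /sqr_sum mulr_sumr; apply: eq_bigr => k _.
  by rewrite -exprMn /b mulrC divfK// gt_eqF.
have phi0 : 0 <= phi := sqr_sum_ge0 _ _.
have A0 : 0 <= abs_sum n.+1 c0 by apply: sumr_ge0.
rewrite cE; apply: (@le_trans _ _ (lp_norm 1 c0 + ta%:E * lp_norm 2 c1)%E).
  apply: K_functional_ub.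
    by apply: le_lt_trans c01 _; rewrite ltry.
  by apply: le_lt_trans c12 _; rewrite ltry.
apply: (@le_trans _ _ ((abs_sum n.+1 c0)%:E + ta%:E * (l * ta)%:E)%E).
  by apply: leeD => //; apply: lee_wpmul2l => //; rewrite lee_fin ltW.
rewrite -EFinM -!EFinD lee_fin.
have tu : ta * u = ta * U + e / 12 by rewrite /u; field; rewrite gt_eqF.
have ll : ta * (l * ta) = l * ta ^+ 2 by ring.
rewrite ll; have lphi0 : 0 <= l * phi by rewrite mulr_ge0// ltW.
rewrite -mulrA tu in B; have taU : 0 <= ta * U by rewrite mulr_ge0// ltW.
case: phi_ge => [h|h]; last by lra.
by have := ler_wpM2l (ltW l0) h; lra.
Qed.

(** Truncating a changes both K-functionals by at most a multiple of the l_2 norm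
    of the tail. *)
Lemma K_rademacher_sum_ge1 a (ta : R) : 1 <= ta -> in_space (lp_norm 2) a ->
  (K_functional (lp_norm 1) (lp_norm 2) ta a <=
   6%:E * K_functional Linfty_norm G_norm ta (rademacher_sum a))%E.
Proof.
move=> ta1 a2; have ta0 : 0 < ta by exact: lt_le_trans ta1.
have sI := @Linfty_seminorm R; have sG := @G_seminorm R.
have s1 := @l1_seminorm R; have s2 := @l2_seminorm R.
apply/lee_addgt0Pr => e e0.
have [|n /(_ _ (leqnSn n)) tail] := l2_tail_small (e := e / (25 * ta)) a2.
  by rewrite divr_gt0// mulr_gt0.
set c := seq_take n.+1 a; set r := seq_tail n.+1 a in tail.
have r2 : in_space (lp_norm 2) r := l2_seq_tail n.+1 a2.
set eps := e / (25 * ta) in tail.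
have eps0 : 0 <= eps by rewrite divr_ge0 ?(ltW e0)// mulr_ge0// ltW.
have Kr : (K_functional (lp_norm 1) (lp_norm 2) ta r <= (ta * eps)%:E)%E.
  have := K_functional_ub ta (in_space0 s1) r2.
  rewrite add0r (seminorm0 s1) add0e => /le_trans; apply.
  by rewrite EFinM; apply: lee_wpmul2l => //; rewrite lee_fin ltW.
have Kc : (K_functional (lp_norm 1) (lp_norm 2) ta c <=
    6%:E * K_functional Linfty_norm G_norm ta (rademacher_sum c))%E.
  rewrite -lee_pdivrMl//; apply: le_ereal_inf_tmp => _ [x0 [x1 [xE x0i x1G ->]]].
  by rewrite lee_pdivrMl//; exact: K_rademacher_take_ge.
have KT : (K_functional Linfty_norm G_norm ta (rademacher_sum c) <=
    K_functional Linfty_norm G_norm ta (rademacher_sum a) + (4 * ta * eps)%:E)%E.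
  have -> : rademacher_sum c = rademacher_sum a + (rademacher_sum c - rademacher_sum a).
    by rewrite addrC subrK.
  apply: le_trans (K_functionalD sI sG (ltW ta0) _ _) _; apply: leeD2l.
  have dG : in_G (rademacher_sum c - rademacher_sum a).
    rewrite -scaleN1r; apply: in_GD; last by apply: in_GZ; exact: in_G_rademacher_sum.
    by apply: in_G_rademacher_sum; exact: l2_seq_take.
  have := K_functional_ub ta (in_space0 sI) ((in_space_G _).2 dG).
  rewrite add0r (seminorm0 sI) add0e => /le_trans; apply.
  rewrite (G_normE dG) (seminormC (@LN_seminorm R)).
  have h := le_trans (LN_rademacher_tail n.+1 a2)
    (lee_wpmul2l (_ : (0 <= 4%:E)%E) tail).
  rewrite [4 * ta]mulrC -mulrA EFinM; apply: lee_wpmul2l; first by rewrite lee_fin ltW.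
  by rewrite EFinM h// lee_fin.
rewrite -{1}(seq_take_tail n.+1 a).
apply: le_trans (K_functionalD s1 s2 (ltW ta0) _ _) _.
apply: le_trans (leeD (le_trans Kc (lee_wpmul2l _ KT)) Kr) _; first by rewrite lee_fin.
rewrite ge0_muleDr ?K_functional_ge0 ?(ltW ta0)//; last first.
  by rewrite lee_fin; apply: mulr_ge0 => //; rewrite mulr_ge0// ltW.
rewrite -addeA leeD2l// -EFinM -EFinD lee_fin.
rewrite (_ : 6 * (4 * ta * eps) + ta * eps = e)//.
by rewrite /eps; field; rewrite gt_eqF.
Qed.

(** For t <= 1 the K-functional of the couple (l_1, l_2) is t times the l_2 norm,
    and K(t, .) >= t K(1, .) for the other couple. *)
Lemma K_rademacher_sum_ge a (t : R) : 0 < t -> in_space (lp_norm 2) a ->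
  (K_functional (lp_norm 1) (lp_norm 2) t a <=
   6%:E * K_functional Linfty_norm G_norm t (rademacher_sum a))%E.
Proof.
move=> t0 a2; have [t1|/ltW t1] := leP 1 t; first exact: K_rademacher_sum_ge1.
have s1 := @l1_seminorm R; have s2 := @l2_seminorm R.
have sI := @Linfty_seminorm R; have sG := @G_seminorm R.
have K1 : (lp_norm 2 a <= K_functional (lp_norm 1) (lp_norm 2) 1 a)%E.
  apply: le_ereal_inf_tmp => _ [a0 [a1 [-> _ _ ->]]].
  apply: le_trans (seminormD s2 _ _) _; rewrite mul1e.
  by apply: leeD2r; exact: l2_le_l1.
have KT : (t%:E * K_functional Linfty_norm G_norm 1 (rademacher_sum a) <=
    K_functional Linfty_norm G_norm t (rademacher_sum a))%E.
  apply: le_ereal_inf_tmp => _ [x0 [x1 [xE x0i x1G ->]]].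
  have := K_functional_ub 1 x0i x1G; rewrite -xE mul1e => h.
  apply: le_trans (lee_wpmul2l _ h) _; first by rewrite lee_fin ltW.
  rewrite ge0_muleDr ?Linfty_ge0 ?G_ge0//; apply: leeD2r.
  by rewrite -[leRHS]mul1e lee_wpmul2r ?Linfty_ge0// lee_fin.
have := K_functional_ub t (in_space0 s1) a2.
rewrite add0r (seminorm0 s1) add0e => /le_trans; apply.
apply: le_trans (lee_wpmul2l _ K1) _; first by rewrite lee_fin ltW.
apply: le_trans (lee_wpmul2l _ (K_rademacher_sum_ge1 (lexx 1) a2)) _.
  by rewrite lee_fin ltW.
by rewrite muleCA lee_wpmul2l// lee_fin.
Qed.

End rademacher_lower_bound.

(** * Rademacher sums in the spaces of the K-method *)

Theorem theorem2 (R : realType)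
    (E : (int -> R) -> \bar R) (F : (nat -> R) -> \bar R)
    (E_lattice : is_banach_sequence_lattice E)
    (E_min : in_space E (fun k : int => Num.min 1 (2%:R ^ k)))
    (F_banach : is_banach [set 0] F)
    (F_interpolation : interpolation_space (lp_norm 1) (lp_norm 2%:R) F)
    (F_eq : norms_asymp_on setT F (K_method (lp_norm 1) (lp_norm 2%:R) E)) :
  let X : (R -> R) -> \bar R := K_method Linfty_norm G_norm E in
  rearrangement_invariant X /\
  norms_asymp_on [set a : nat -> R | in_space (lp_norm 2%:R) a]
    (fun a => X (rademacher_sum a)) F.
Proof.
move=> X; split; first exact: K_method_Linfty_G_rearrangement_invariant.
have s1 := @l1_seminorm R; have s2 := @l2_seminorm R.
have sI := @Linfty_seminorm R; have sG := @G_seminorm R.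
case: F_eq => c [C [c0 C0 FE]].
exists (6 * C)^-1, (4 / c); split; [by rewrite invr_gt0 mulr_gt0|exact: divr_gt0|].
move=> a /= a2; have [Fl Fu] := FE a I.
have aS : in_sum (lp_norm 1) (lp_norm 2) a.
  by exists 0, a; rewrite add0r; split=> //; exact: (in_space0 s1).
have TS : in_sum Linfty_norm G_norm (rademacher_sum a).
  exists 0, (rademacher_sum a); rewrite add0r; split=> //.
    exact: (in_space0 sI).
  by apply/in_space_G; exact: in_G_rademacher_sum.
split.
  rewrite lee_pdivrMl ?mulr_gt0//; apply: le_trans Fu _.
  rewrite mulrC EFinM -muleA; apply: lee_wpmul2l; first by rewrite lee_fin ltW.
  apply: le_K_method => // k; apply: K_rademacher_sum_ge => //; exact: exp2z_gt0.
apply: (@le_trans _ _ (4%:E * K_method (lp_norm 1) (lp_norm 2) E a)%E).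
  by apply: le_K_method => // k; apply: K_rademacher_sum_le; exact: exp2z_ge0.
rewrite EFinM -muleA; apply: lee_wpmul2l; first by rewrite lee_fin.
by rewrite -lee_pdivrMl ?invr_gt0// invrK.
Qed.
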